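(* Let $\mathbb{G}$ be a homogeneous group with homogeneous dimension $Q$ equipped with a quasi-norm $|\cdot|$. Let $0<p\le q<\infty$, $a,b\in\mathbb{R}$ and $\epsilon>0$. Then the inequality $$\left(\int_{\mathbb{G}}\left[\exp\left(\epsilon\,|\mathbb{B}(0,|x|)|^{-\epsilon}\int_{\mathbb{B}(0,|x|)}|\mathbb{B}(0,|y|)|^{\epsilon-1}\log f(y)\,dy\right)\right]^q|\mathbb{B}(0,|x|)|^a\,dx\right)^{\frac1q}\le C\left(\int_{\mathbb{G}}f^p(x)\,|\mathbb{B}(0,|x|)|^b\,dx\right)^{\frac1p}$$ holds for all positive functions $f$ on $\mathbb{G}$ with some positive finite constant $C$ (independent of $f$) if and only if $$p(a+1)-q(b+1)=0.$$ Moreover, the best constant $C$ in this inequality satisfies $$\left(\frac pq\right)^{\frac1q}\epsilon^{\frac1p-\frac1q}\exp\left(\frac{b+1}{\epsilon p}-\frac1p\right)\le C\le\left(\frac pq\right)^{\frac1q}\epsilon^{\frac1p-\frac1q}\exp\left(\frac{b+1}{\epsilon p}\right).$$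
   Context: A homogeneous group $\mathbb{G}$ is a Lie group identified with $(\mathbb{R}^N,\circ)$ equipped with dilations $D_\lambda(x)=(\lambda^{v_1}x_1,\dots,\lambda^{v_N}x_N)$, $v_1,\dots,v_N>0$, which are automorphisms of the group for every $\lambda>0$; one writes $\lambda x$ for $D_\lambda(x)$. Its homogeneous dimension is $Q=v_1+\dots+v_N$. The Haar measure $dx$ is Lebesgue measure on $\mathbb{R}^N$, and $|\omega|$ denotes the Haar measure of a measurable set $\omega\subset\mathbb{G}$. A quasi-norm is a continuous function $|\cdot|:\mathbb{G}\to[0,\infty)$ with $|x^{-1}|=|x|$ for all $x$, $|\lambda x|=\lambda|x|$ for all $x$ and $\lambda>0$, and $|x|=0$ if and only if $x=0$. $\mathbb{B}(0,r)$ is the quasi-ball $\{y\in\mathbb{G}:|y|<r\}$. With $\mathfrak{S}=\{x\in\mathbb{G}:|x|=1\}$ and $\sigma$ the unique Radon measure on $\mathfrak{S}$ such that $\int_{\mathbb{G}}f(x)\,dx=\int_0^\infty\int_{\mathfrak{S}}f(ry)\,r^{Q-1}\,d\sigma(y)\,dr$ for all $f\in L^1(\mathbb{G})$, one has $|\mathbb{B}(0,|x|)|=|x|^Q|\mathfrak{S}|/Q$, where $|\mathfrak{S}|=\sigma(\mathfrak{S})$. The best constant is the least $C$ for which the inequality holds for all positive functions $f$. *)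

(* Defs.v *)
From HB Require Import structures.
From mathcomp Require Import all_boot all_order all_algebra.
From mathcomp Require Import all_classical all_reals all_analysis.
From mathcomp Require Import measurable_realfun.

Set Implicit Arguments.
Unset Strict Implicit.
Unset Printing Implicit Defensive.

Import Order.TTheory GRing.Theory Num.Theory.
Import numFieldNormedType.Exports.

Local Open Scope classical_set_scope.
Local Open Scope ring_scope.

(* The sigma-algebra on R^n generated by the coordinates, as for n.-tuple T in
   the library; it is the Borel sigma-algebra by [measurable_rVE]. *)
Definition rV_display : measure_display. Proof. exact. Qed.

Section measurable_rV.
Context (R : realType) (n : nat).

Let coors : 'I_n -> 'rV[R]_n -> R := fun i v => v ord0 i.

Let rV_set0 : g_sigma_preimage coors set0.
Proof. exact: sigma_algebra0. Qed.

Let rV_setC A : g_sigma_preimage coors A -> g_sigma_preimage coors (~` A).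
Proof. exact: sigma_algebraC. Qed.

Let rV_bigcup (F : _^nat) : (forall i, g_sigma_preimage coors (F i)) ->
  g_sigma_preimage coors (\bigcup_i (F i)).
Proof. exact: sigma_algebra_bigcup. Qed.

HB.instance Definition _ := @isMeasurable.Build rV_display
  'rV[R]_n (g_sigma_preimage coors) rV_set0 rV_setC rV_bigcup.

End measurable_rV.

Section measurable_rV_theory.
Context (R : realType).

Lemma measurable_coord n (i : 'I_n) :
  measurable_fun [set: 'rV[R]_n] (fun v => v ord0 i).
Proof.
move=> _ Y mY; rewrite setTI; apply: sub_sigma_algebra => /=.
rewrite -bigcup_seq/=; exists i => /=; first by rewrite mem_index_enum.
by exists Y => //; rewrite setTI.
Qed.

Lemma measurable_fun_rVP n d (T : measurableType d) (f : T -> 'rV[R]_n) :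
  (forall i, measurable_fun [set: T] (fun x => f x ord0 i)) ->
  measurable_fun [set: T] f.
Proof.
move=> mf; apply: measurability; first by [].
move=> _ [B + <-]; rewrite -bigcup_seq => -[i _ [A mA <-]].
by rewrite setTI -comp_preimage; exact: mf.
Qed.

Definition rV_cons n (xv : R * 'rV[R]_n) : 'rV[R]_n.+1 :=
  \row_i oapp (fun j => xv.2 ord0 j) xv.1 (unlift ord0 i).

Definition rV_uncons n (v : 'rV[R]_n.+1) : R * 'rV[R]_n :=
  (v ord0 ord0, \row_j v ord0 (lift ord0 j)).

Lemma rV_consK n : cancel (@rV_cons n) (@rV_uncons n).
Proof.
move=> [x v]; rewrite /rV_uncons /rV_cons; congr pair.
  by rewrite mxE unlift_none.
by apply/rowP => j; rewrite !mxE liftK.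
Qed.

Lemma measurable_rV_cons n : measurable_fun setT (@rV_cons n).
Proof.
apply: measurable_fun_rVP => i; case: (unliftP ord0 i) => [j ->|->].
- have -> : (fun x => rV_cons x ord0 (lift ord0 j)) =
      (fun v : 'rV[R]_n => v ord0 j) \o snd.
    by apply/funext => x; rewrite mxE liftK.
  by apply: measurableT_comp => //; exact: measurable_coord.
- have -> : (fun x => @rV_cons n x ord0 ord0) = fst => //.
  by apply/funext => x; rewrite mxE unlift_none.
Qed.

Lemma measurable_rV_uncons n : measurable_fun setT (@rV_uncons n).
Proof.
apply/measurable_fun_pairP; split; first exact: measurable_coord.
apply: measurable_fun_rVP => i.
have -> : (fun v => (@rV_uncons n v).2 ord0 i) =
    (fun v => v ord0 (lift ord0 i)).
  by apply/funext => v; rewrite mxE.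
exact: measurable_coord.
Qed.

Lemma open_measurable_rV n (U : set 'rV[R]_n) : open U -> measurable U.
Proof.
move=> oU.
pose B (cr : 'rV[rat]_n * rat) : set 'rV[R]_n :=
  [set v | forall i, `|ratr (cr.1 ord0 i) - v ord0 i| < ratr cr.2].
have mB cr : measurable (B cr).
  rewrite (_ : B cr = \bigcap_(i in [set: 'I_n])
      (fun v : 'rV[R]_n => v ord0 i) @^-1`
        [set x | `|ratr (cr.1 ord0 i) - x| < ratr cr.2]); last first.
    by apply/seteqP; split => v /= h i; [move=> _|]; exact: h.
  apply: fin_bigcap_measurable => // i _.
  rewrite -[X in measurable X]setTI; apply: measurable_coord => //.
  by apply: open_measurable; exact: (@ball_open _ R^o).
have -> : U = \bigcup_(cr in [set cr | B cr `<=` U]) B cr.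
  apply/seteqP; split => [v Uv|v [cr /= sub] /sub //].
  have /nbhs_ballP[e /= e0 eU] : nbhs v U by exact: open_nbhs_nbhs.
  have /rat_in_itvoo[r] : 0 < e / 2 by rewrite divr_gt0.
  rewrite in_itv/= => /andP[r0 re].
  have /choice[c cP] (i : 'I_n) :
      exists c : rat, `|ratr c - v ord0 i| < ratr r.
    have /rat_in_itvoo[c] : v ord0 i - ratr r < v ord0 i + ratr r.
      by rewrite ltrBlDr -addrA ltrDl addr_gt0.
    by rewrite in_itv/= -ltr_distl; exists c.
  exists (\row_i c i, r); last by move=> i /=; rewrite mxE.
  move=> w /= wP; apply: eU; split=> // j i; rewrite !ord1.
  have := wP i; rewrite /= mxE => wi.
  rewrite /ball/= -(subrKA (ratr (c i))) (splitr e).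
  apply: (le_lt_trans (ler_normD _ _)); apply: ltrD.
    by apply: lt_trans re; rewrite distrC.
  exact: lt_trans re.
rewrite bigcup_mkcond; apply: countable_bigcupT_measurable => [|cr].
  exact: countableP.
by case: ifPn.
Qed.

Lemma measurable_rVE n :
  @measurable _ 'rV[R]_n = <<s @open 'rV[R]_n >>.
Proof.
apply/seteqP; split; last first.
  apply: smallest_sub; first exact: sigma_algebra_measurable.
  exact: open_measurable_rV.
apply: smallest_sub; first exact: smallest_sigma_algebra.
move=> B; rewrite -bigcup_seq => -[i _ [A mA <-]] {B}.
suff /(_ _ mA) : measurable `<=`
    image_set_system setT (fun v : 'rV[R]_n => v ord0 i) <<s @open 'rV[R]_n >>.
  by rewrite /image_set_system.
have -> : (measurable : set (set R)) = (@RGenOpens.G R).-sigma.-measurable.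
  exact: (RGenOpens.measurableE R).
apply: smallest_sub; first exact/sigma_algebra_image/smallest_sigma_algebra.
move=> _ [x [y ->]]; rewrite /image_set_system/= setTI.
apply: sub_sigma_algebra; apply: open_comp => [v _|]; first exact: coord_continuous.
exact: interval_open.
Qed.

End measurable_rV_theory.

(* Lebesgue measure on R^n, as an iterated product measure; [lebesgue_rV_prod]
   gives its value on measurable rectangles. *)
Fixpoint lebesgue_rV (R : realType) (n : nat) : set 'rV[R]_n -> \bar R :=
  match n with
  | 0 => \d_(0 : 'rV[R]_0)
  | n.+1 => pushforward (@lebesgue_measure R \x @lebesgue_rV R n)%E (@rV_cons R n)
  end.
Arguments lebesgue_rV {R n}.

Section lebesgue_rV_measure.
Context (R : realType).
Local Open Scope ereal_scope.

Lemma sigma_finite_rV_cons n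
    (m : {sigma_finite_measure set (measurableTypeR R) -> \bar R})
    (mu : {sigma_finite_measure set 'rV[R]_n -> \bar R}) :
  sigma_finite setT (pushforward (m \x mu) (@rV_cons R n)).
Proof.
have /sigma_finiteP[F [TF ndF Foo]] := sigma_finiteT m.
have /sigma_finiteP[G [TG ndG Goo]] := sigma_finiteT mu.
exists (fun i => @rV_uncons R n @^-1` (F i `*` G i)).
  rewrite -preimage_bigcup (_ : \bigcup_i _ = setT) ?preimage_setT//.
  rewrite -setXTT TF TG predeqE => -[x y]; split.
    by move=> [n0 _ []/= ? ?]; split; exists n0.
  move=> [/= [i _ Fx] [k _ Gy]]; exists (maxn i k) => //; split.
  - by move: x Fx; exact/subsetPset/ndF/leq_maxl.
  - by move: y Gy; exact/subsetPset/ndG/leq_maxr.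
move=> k; have [mF Fk] := Foo k; have [mG Gk] := Goo k; split.
  rewrite -[X in measurable X]setTI.
  by apply: measurable_rV_uncons => //; exact: measurableX.
rewrite /pushforward -comp_preimage.
have -> : @rV_uncons R n \o @rV_cons R n = id.
  by apply/funext => x /=; rewrite rV_consK.
by rewrite preimage_id product_measure1E// lte_mul_pinfty// ge0_fin_numE.
Qed.

Lemma lebesgue_rV_sigma_finite_measure n :
  exists mu : {sigma_finite_measure set 'rV[R]_n -> \bar R},
    (mu : set 'rV[R]_n -> \bar R) = lebesgue_rV.
Proof.
elim: n => [|n [mu muE]]; first by exists (\d_(0%R : 'rV[R]_0)).
pose m : {sigma_finite_measure set (measurableTypeR R) -> \bar R} :=
  @lebesgue_measure R.
pose nu : {measure set 'rV[R]_n.+1 -> \bar R} :=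
  measure_function_pushforward__canonical__measure_function_Measure (m \x mu)
    (@measurable_rV_cons R n).
pose snu := Measure_isSigmaFinite.Build _ _ _ nu (sigma_finite_rV_cons m mu).
pose nu' : {sigma_finite_measure set 'rV[R]_n.+1 -> \bar R} :=
  HB.pack (nu : set _ -> \bar R) nu snu.
by exists nu'; rewrite /= -muE.
Qed.

Let lebesgue_rV0 n : @lebesgue_rV R n set0 = 0.
Proof. by have [mu <-] := lebesgue_rV_sigma_finite_measure n. Qed.

Let lebesgue_rV_ge0 n A : 0 <= @lebesgue_rV R n A.
Proof. by have [mu <-] := lebesgue_rV_sigma_finite_measure n. Qed.

Let lebesgue_rV_semi_sigma_additive n : semi_sigma_additive (@lebesgue_rV R n).
Proof.
have [mu <-] := lebesgue_rV_sigma_finite_measure n.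
exact: measure_semi_sigma_additive.
Qed.

HB.instance Definition _ n := isMeasure.Build _ _ _ (@lebesgue_rV R n)
  (@lebesgue_rV0 n) (@lebesgue_rV_ge0 n) (@lebesgue_rV_semi_sigma_additive n).

Let lebesgue_rV_sigma_finite n : sigma_finite setT (@lebesgue_rV R n).
Proof.
have [mu <-] := lebesgue_rV_sigma_finite_measure n.
exact: sigma_finiteT.
Qed.

HB.instance Definition _ n := Measure_isSigmaFinite.Build _ _ _
  (@lebesgue_rV R n) (@lebesgue_rV_sigma_finite n).

Lemma lebesgue_rV_prod n (A : 'I_n -> set R) : (forall i, measurable (A i)) ->
  lebesgue_rV [set v : 'rV[R]_n | forall i, A i (v ord0 i)] =
  \prod_(i < n) lebesgue_measure (A i).
Proof.
elim: n A => [|n IH] A mA.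
  rewrite big_ord0/= diracE mem_set//=; first by case.
rewrite big_ord_recl -(IH (A \o lift ord0))//=.
rewrite /pushforward; set B := _ @^-1` _.
have -> : B = A ord0 `*`
    [set v : 'rV[R]_n | forall i, A (lift ord0 i) (v ord0 i)].
  apply/seteqP; split=> [[x v]/= Bxv|[x v]/= [Ax Av] i].
    split=> [|i]; first by have := Bxv ord0; rewrite mxE unlift_none.
    by have := Bxv (lift ord0 i); rewrite mxE liftK.
  by case: (unliftP ord0 i) => [j ->|->]; rewrite mxE ?liftK ?unlift_none.
rewrite product_measure1E//; first exact: mA.
rewrite (_ : [set v | _] = \bigcap_(i in [set: 'I_n])
    (fun v : 'rV[R]_n => v ord0 i) @^-1` A (lift ord0 i)); last first.
  by apply/seteqP; split => v /= h i; [move=> _|]; exact: h.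
apply: fin_bigcap_measurable => // i _.
by rewrite -[X in measurable X]setTI; apply: measurable_coord.
Qed.

End lebesgue_rV_measure.

Section smooth.
Context (R : realType) (V W : normedModType R).

(* C^k through iterated directional derivatives, all of them continuous. *)
Fixpoint Ck (k : nat) (f : V -> W) : Prop :=
  continuous f /\
  if k is k'.+1 then
    forall v, (forall x, derivable f x v) /\ Ck k' (fun x => 'D_v f x)
  else True.

Definition smooth (f : V -> W) : Prop := forall k, Ck k f.

End smooth.

Definition dilation (R : realType) (N : nat) (w : 'I_N -> R) (l : R)
  (x : 'rV[R]_N) : 'rV[R]_N := \row_i (l `^ w i * x ord0 i).

(* The identity of the group is the origin: an identity is fixed by every
   dilation, and 0 is the only such point since the weights are positive. *)
Record homogeneous_group (R : realType) (N : nat) := HomogeneousGroup {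
  hg_mul : 'rV[R]_N -> 'rV[R]_N -> 'rV[R]_N ;
  hg_inv : 'rV[R]_N -> 'rV[R]_N ;
  hg_weight : 'I_N -> R ;
  hg_mulA : associative hg_mul ;
  hg_0mul : left_id 0 hg_mul ;
  hg_mul0 : right_id 0 hg_mul ;
  hg_Vmul : left_inverse 0 hg_inv hg_mul ;
  hg_mulV : right_inverse 0 hg_inv hg_mul ;
  hg_mul_smooth :
    smooth (fun xy : 'rV[R]_N * 'rV[R]_N => hg_mul xy.1 xy.2) ;
  hg_inv_smooth : smooth hg_inv ;
  hg_weight_gt0 : forall i, 0 < hg_weight i ;
  hg_dilationM : forall l, 0 < l ->
    {morph dilation hg_weight l : x y / hg_mul x y} }.

Definition hg_dim (R : realType) (N : nat) (G : homogeneous_group R N) : R :=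
  \sum_i hg_weight G i.

Record quasi_norm (R : realType) (N : nat) (G : homogeneous_group R N) :=
  QuasiNorm {
  qn :> 'rV[R]_N -> R ;
  qn_continuous : continuous qn ;
  qn_ge0 : forall x, 0 <= qn x ;
  qn_inv : forall x, qn (hg_inv G x) = qn x ;
  qn_dilation : forall l x, 0 < l -> qn (dilation (hg_weight G) l x) = l * qn x ;
  qn_eq0 : forall x, qn x = 0 <-> x = 0 }.

Section hardy.
Context (R : realType) (N : nat) (G : homogeneous_group R N).
Variable nrm : quasi_norm G.

Definition qball (r : R) : set 'rV[R]_N := [set y | nrm y < r].

(* |B(0,|x|)|; quasi-balls are bounded, so [fine] only changes the type. *)
Definition qball_vol (x : 'rV[R]_N) : R := fine (lebesgue_rV (qball (nrm x))).

(* The integral of a function whose positive and negative parts both have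
   infinite integral is -oo in the library.  This never matters below: if the
   right-hand side of the inequality is finite, then the positive part of the
   inner integrand is integrable, so that the inner integral has a value in
   [-oo, +oo[, and exp(-oo) = 0. *)
Definition exp_mean (eps : R) (f : 'rV[R]_N -> R) (x : 'rV[R]_N) : \bar R :=
  expeR ((eps * qball_vol x `^ (- eps))%:E *
    \int[lebesgue_rV]_(y in qball (nrm x))
      (qball_vol y `^ (eps - 1) * ln (f y))%:E)%E.

Definition hardy_constant (p q a b eps C : R) : Prop :=
  0 < C /\
  forall f : 'rV[R]_N -> R, measurable_fun setT f -> (forall x, 0 < f x) ->
  ((\int[lebesgue_rV]_x (exp_mean eps f x `^ q * (qball_vol x `^ a)%:E)) `^ q^-1
   <= C%:E *
      (\int[lebesgue_rV]_x (f x `^ p * qball_vol x `^ b)%:E) `^ p^-1)%E.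

Definition best_hardy_constant (p q a b eps C : R) : Prop :=
  hardy_constant p q a b eps C /\
  forall C', hardy_constant p q a b eps C' -> C <= C'.

End hardy.

(* Main.v *)
Require Import Defs.
From mathcomp Require Import all_boot all_order all_algebra.
From mathcomp Require Import all_classical all_reals all_analysis.
From mathcomp Require Import measurable_realfun ring lra.

Set Implicit Arguments.
Unset Strict Implicit.
Unset Printing Implicit Defensive.

Import Order.TTheory GRing.Theory Num.Theory.
Import numFieldNormedType.Exports.

Local Open Scope classical_set_scope.
Local Open Scope ring_scope.

(** Put V(x) = |B(0,|x|)|.  All that matters about the group is that V carries
    Haar measure to Lebesgue measure on the half-line: |{V < t}| = t for t > 0.
    Dilations multiply Haar measure by l^Q ([lebesgue_rV_dilation]) and the unit
    quasi-ball has positive finite volume, so that V is a positive multiple of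
    |x|^Q; this gives [lebesgue_qball_vol_lt].  From there on one works on a
    measure space (T, mu) with a function V such that mu {V < t} = t.

    Below, e is the exponent eps.

    Upper bound ([radial_hardy_upper]).  On {V < t}, with density
    e t^-e V^(e-1), one has a probability measure for which ln V has mean
    ln t - 1/e.  Put r = q / p and g = f^p V^b.  Jensen's inequality for exp,
    applied to p ln f + (b+1) ln V, bounds the p-th power of the geometric mean
    of f at t by
      exp((b+1)/e) t^-(b+1) e t^-e  int_(V < t) V^e g.
    Since r >= 1, Jensen's inequality for the power r and the measure g dx gives
      (int_(V < t) V^e g)^r <= (int g)^(r-1) int_(V < t) V^(e r) g.
    If a + 1 = r (b+1), all powers of t combine into t^(-e r - 1), and Tonelli's
    theorem evaluates the remaining double integral as (int g) / (e r).

    Lower bound and necessity ([radial_hardy_lower]).  Let f be given by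
    f^p V^(b+1) = (V/tau)^al where V < tau, and k (V/tau)^-al elsewhere.  The
    weighted integral of f^p is (1+k)/al for every tau, and on {V < tau} the
    geometric mean of f is an explicit power of V.  If only this region is kept
    on the left-hand side, a multiple of tau^(D/q) with D = a + 1 - r (b+1)
    remains below a constant, for all tau > 0; hence D = 0.  When D = 0, the
    choice al = e and the limit k -> 0 yield the lower bound for the constant.

    The inequality is closed in C and the admissible constants are bounded below
    by a positive number, so that their infimum is the best constant. *)

(** * Dilations and Lebesgue measure *)
Section dilation.
Context {R : realType}.

Lemma lebesgue_measure_scale (k : R) (A : set R) : 0 < k -> measurable A ->
  lebesgue_measure ((fun x => k * x) @^-1` A) =
  (k^-1%:E * lebesgue_measure A)%E.
Proof.
move=> k0 mA.
have mk : measurable_fun [set: measurableTypeR R]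
    (fun x => k * x : measurableTypeR R) by exact: mulrl_measurable.
pose m : {measure set (measurableTypeR R) -> \bar R} :=
  mscale (NngNum (ltW k0))
      (measure_function_pushforward__canonical__measure_function_Measure
        lebesgue_measure mk).
have mE : forall X, ocitv X -> lebesgue_measure X = m X.
  move=> _ [[a b] /= _ <-]; rewrite /m /mscale/= /pushforward.
  have -> : (fun x => k * x) @^-1` `]a, b]%classic = `]a / k, b / k]%classic.
    apply/seteqP; split=> x /=; rewrite !in_itv/= ltr_pdivrMr// ler_pdivlMr//;
    by rewrite mulrC.
  rewrite !lebesgue_measure_itv/= !lte_fin ltr_pM2r ?invr_gt0//.
  case: ifPn => _; last by rewrite mule0.
  by rewrite -!EFinB -EFinM mulrBr !(mulrCA k) divff ?gt_eqF// !mulr1.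
have := lebesgue_measure_unique mE mA.
rewrite /m /mscale/= /pushforward => ->.
by rewrite muleA -EFinM mulVf ?gt_eqF// mul1e.
Qed.

Lemma measurable_dilation n (w : 'I_n -> R) (l : R) :
  measurable_fun setT (dilation w l).
Proof.
apply: measurable_fun_rVP => i.
rewrite [X in measurable_fun _ X](_ : _ = fun v : 'rV[R]_n => l `^ w i * v ord0 i).
  by apply: measurable_funM => //; exact: measurable_coord.
by apply/funext => v; rewrite mxE.
Qed.

(** By induction on the dimension: scaling one coordinate and dilating the others
    multiplies the measure of every rectangle by the same factor, and a product
    measure is determined by its values on rectangles. *)
Lemma lebesgue_rV_dilation n (w : 'I_n -> R) (l : R) (A : set 'rV[R]_n) :
  0 < l -> measurable A ->
  lebesgue_rV (dilation w l @^-1` A) =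
  ((l `^ (- \sum_i w i))%:E * lebesgue_rV A)%E.
Proof.
move=> l0; elim: n w A => [|n IH] w A mA.
  rewrite big_ord0 oppr0 powRr0 mul1e; congr lebesgue_rV.
  by rewrite (_ : dilation w l = id) ?preimage_id//; apply/funext => v; by apply/rowP; case.
pose w' := w \o lift ord0; pose s := \sum_i w i.
pose D (xv : measurableTypeR R * 'rV[R]_n) : measurableTypeR R * 'rV[R]_n :=
  (l `^ w ord0 * xv.1, dilation w' l xv.2).
have mD : measurable_fun setT D.
  apply/measurable_fun_pairP; split.
    apply: (measurableT_comp (f := fun x : R => l `^ w ord0 * x)) => //.
    exact: mulrl_measurable.
  by apply: (measurableT_comp (f := dilation w' l)) => //; exact: measurable_dilation.
pose m : {measure set (measurableTypeR R * 'rV[R]_n) -> \bar R} :=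
  mscale (NngNum (powR_ge0 l s))
      (measure_function_pushforward__canonical__measure_function_Measure
        (lebesgue_measure \x lebesgue_rV)%E mD).
have mE X Y : measurable X -> measurable Y ->
    m (X `*` Y) = (lebesgue_measure X * lebesgue_rV Y)%E.
  move=> mX mY.
  have -> : m (X `*` Y) = ((l `^ s)%:E * (lebesgue_measure \x lebesgue_rV)
      ((fun x => (l `^ w ord0 * x)%R) @^-1` X `*` dilation w' l @^-1` Y))%E by [].
  rewrite product_measure1E; last 2 first.
  - by rewrite -[X in measurable X]setTI; exact: mulrl_measurable.
  - by rewrite -[X in measurable X]setTI; exact: measurable_dilation.
  transitivity ((l `^ s)%:E * (lebesgue_measure ((fun x => (l `^ w ord0 * x)%R) @^-1` X) *
    lebesgue_rV (dilation w' l @^-1` Y)))%E => //.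
  rewrite lebesgue_measure_scale ?powR_gt0// IH// -powRN muleACA muleA.
  have dl x y : l `^ (x + y) = l `^ x * l `^ y.
    by rewrite powRD// (gt_eqF l0) implybT.
  rewrite -!EFinM -!dl -opprD.
  rewrite (_ : w ord0 + _ = s); last by rewrite /s big_ord_recl.
  by rewrite !muleA -EFinM -dl subrr powRr0 mul1e.
have mcA : measurable (@rV_cons R n @^-1` A).
  by rewrite -[X in measurable X]setTI; exact: measurable_rV_cons.
have /(_ _ mcA) := product_measure_unique mE.
rewrite /m /mscale/= /pushforward => ->.
rewrite muleA -EFinM -powRD; last by rewrite (gt_eqF l0) implybT.
rewrite addNr powRr0 mul1e; congr (product_measure1 _ _ _).
apply/seteqP; split => -[x v] /=.
all: suff -> : dilation w l (rV_cons (x, v)) = rV_cons (D (x, v)) by [].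
all: apply/rowP => i; rewrite !mxE; case: (unliftP ord0 i) => [j|] -> /=.
all: by rewrite ?mxE.
Qed.

End dilation.

(** * Volume of quasi-balls *)

Section quasi_ball.
Context {R : realType} {N : nat} (G : homogeneous_group R N).
Variable nrm : quasi_norm G.
Let w := hg_weight G.
Let Q := hg_dim G.

Lemma measurable_qball r : measurable (qball nrm r).
Proof.
apply: open_measurable_rV; rewrite /qball.
rewrite (_ : [set y | nrm y < r] = nrm @^-1` [set x | x < r])//.
apply: open_comp => [x _|]; first exact: qn_continuous.
exact: open_lt.
Qed.

(** The face |x_i| = 1 of the unit cube is compact and avoids the origin. *)
Lemma qn_ge_coord (i : 'I_N) : exists2 m : R, 0 < m &
  forall x : 'rV[R]_N,
    (forall j, `|x ord0 j| <= 1) -> `|x ord0 i| = 1 -> m <= nrm x.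
Proof.
pose A (j : 'I_N) : set R := if j == i then [set -1; 1] else `[-1, 1]%classic.
pose S : set 'rV[R]_N := [set v | forall j, A j (v ord0 j)].
have cS : compact S.
  apply: rV_compact => j; rewrite /A; case: ifP => _; last exact: segment_compact.
  by apply: finite_compact; exact: finite_set2.
have S0 : S !=set0.
  exists (const_mx 1) => j; rewrite mxE /A; case: ifP => _; first by right.
  by rewrite /= in_itv/= lexx andbT; lra.
have cn : {within S, continuous nrm}.
  by apply: continuous_subspaceT; exact: qn_continuous.
have [c /set_mem Sc cmin] := EVT_min_rV S0 cS cn.
exists (nrm c).
  rewrite lt_neqAle qn_ge0 andbT eq_sym; apply/eqP => /qn_eq0 c0.
  have := Sc i; rewrite c0 mxE /A eqxx => -[|] /eqP.
    by rewrite eq_sym oppr_eq0 oner_eq0.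
  by rewrite eq_sym oner_eq0.
move=> x x1 xi; apply: cmin; apply/mem_set => j; rewrite /A.
case: ifP => [/eqP ->|_]; last by have := x1 j; rewrite /= in_itv/= ler_norml.
have [x0|x0] := leP 0 (x ord0 i); [right|left]; move: xi.
  by rewrite ger0_norm.
by rewrite ltr0_norm// => <-; rewrite opprK.
Qed.

(** If |x_i|^(1/w_i) is the largest among the |x_j|^(1/w_j) and is nonzero, the
    dilation by its inverse moves x to the face i of the unit cube, where the
    quasi-norm is bounded below; by homogeneity |x_i|^(1/w_i) is then at most a
    multiple of the quasi-norm of x. *)
Lemma qball1_bounded : exists2 M : R, 0 < M &
  forall x, nrm x < 1 -> forall j, `|x ord0 j| <= M `^ w j.
Proof.
have /choice[m m_gt0] (i : 'I_N) : exists m : R, 0 < m /\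
    forall x : 'rV[R]_N, (forall j, `|x ord0 j| <= 1) -> `|x ord0 i| = 1 -> m <= nrm x.
  by have [m ? ?] := qn_ge_coord i; exists m.
have m0 i : 0 < m i by case: (m_gt0 i).
pose M : R := 1 + \sum_i (m i)^-1.
have M0 : 0 < M.
  by rewrite ltr_wpDr// sumr_ge0// => i _; rewrite invr_ge0 ltW.
exists M => // x x1 j0.
have w0 i : 0 < w i by exact: hg_weight_gt0.
pose rho i := `|x ord0 i| `^ (w i)^-1.
have rhoK i : rho i `^ w i = `|x ord0 i|.
  by rewrite /rho -powRrM mulVf ?gt_eqF// powRr1.
(* i is the coordinate that determines the size of x *)
case: (@arg_maxP _ _ _ j0 predT rho) => // i _ imax.
rewrite -(rhoK j0).
apply: (@le_trans _ _ (rho i `^ w j0)).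
  by apply: ge0_ler_powR; rewrite ?nnegrE ?powR_ge0 ?(ltW (w0 _))//; exact: imax.
have [ri0|ri0] := eqVneq (rho i) 0.
  by rewrite ri0 powR0 ?gt_eqF// powR_ge0.
have {}ri0 : 0 < rho i by rewrite lt_neqAle eq_sym ri0 powR_ge0.
apply: ge0_ler_powR; rewrite ?nnegrE ?powR_ge0 ?(ltW (w0 _)) ?(ltW M0)//.
pose l := (rho i)^-1.
have l0 : 0 < l by rewrite invr_gt0.
have dE j : `|dilation w l x ord0 j| = (l * rho j) `^ w j.
  rewrite mxE normrM ger0_norm ?powR_ge0// powRM ?(ltW l0) ?powR_ge0//.
  by rewrite rhoK.
have /(m_gt0 i).2 h : forall j, `|dilation w l x ord0 j| <= 1.
  move=> j; rewrite dE (_ : 1 = 1 `^ w j); last by rewrite powR1.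
  apply: ge0_ler_powR; rewrite ?nnegrE ?mulr_ge0 ?(ltW l0) ?powR_ge0 ?(ltW (w0 _))//.
  by rewrite /l ler_pdivrMl// mulr1; exact: imax.
have /h : `|dilation w l x ord0 i| = 1 by rewrite dE mulVf ?gt_eqF// powR1.
rewrite qn_dilation// ler_pdivlMl// => hi.
have : rho i * m i <= 1 by rewrite (le_trans hi)// ltW.
rewrite -ler_pdivlMr// div1r => /le_trans; apply.
rewrite /M (bigD1 i)//= addrCA lerDl addr_ge0// sumr_ge0// => k _.
by rewrite invr_ge0 ltW.
Qed.

Let measurable_box (A : 'I_N -> set R) : (forall i, measurable (A i)) ->
  measurable [set v : 'rV[R]_N | forall i, A i (v ord0 i)].
Proof.
move=> mA; rewrite (_ : [set v | _] = \bigcap_(i in [set: 'I_N])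
    (fun v : 'rV[R]_N => v ord0 i) @^-1` A i); last first.
  by apply/seteqP; split => v /= h i; [move=> _|]; exact: h.
apply: fin_bigcap_measurable => // i _.
by rewrite -[X in measurable X]setTI; apply: measurable_coord.
Qed.

Lemma qball1_lty : (lebesgue_rV (qball nrm 1) < +oo)%E.
Proof.
have [M M0 Mb] := qball1_bounded.
pose A (i : 'I_N) : set R := `[- (M `^ w i), M `^ w i]%classic.
apply: (@le_lt_trans _ _ (lebesgue_rV [set v : 'rV[R]_N | forall i, A i (v ord0 i)])).
  apply: le_measure; rewrite ?inE; first exact: measurable_qball.
    by apply: measurable_box => i; exact: measurable_itv.
  by move=> v /= v1 i; rewrite /A /= in_itv/= -ler_norml Mb.
rewrite lebesgue_rV_prod; last by move=> i; exact: measurable_itv.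
rewrite (eq_bigr (fun i => (M `^ w i + M `^ w i)%:E)).
  by rewrite prodEFin ltry.
move=> i _; rewrite /A lebesgue_measure_itv/= lte_fin gtrN ?powR_gt0//.
by rewrite -EFinB opprK.
Qed.

Lemma qball1_gt0 : (0 < lebesgue_rV (qball nrm 1))%E.
Proof.
have : nbhs (0 : 'rV[R]_N) (qball nrm 1).
  have oB : open (qball nrm 1).
    rewrite (_ : qball nrm 1 = nrm @^-1` [set x | x < 1])//.
    apply: open_comp => [x _|]; first exact: qn_continuous.
    exact: open_lt.
  have B0 : qball nrm 1 0 by rewrite /qball/= (qn_eq0 nrm 0).2.
  exact: open_nbhs_nbhs (conj oB B0).
move=> /nbhs_ballP[e /= e0 eb].
pose A (i : 'I_N) : set R := `]- e, e[%classic.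
apply: (@lt_le_trans _ _ (lebesgue_rV [set v : 'rV[R]_N | forall i, A i (v ord0 i)])).
  rewrite lebesgue_rV_prod; last by move=> i; exact: measurable_itv.
  rewrite (eq_bigr (fun i => (e + e)%:E)).
    by rewrite prodEFin lte_fin prodr_gt0// => i _; rewrite addr_gt0.
  move=> i _; rewrite /A lebesgue_measure_itv/= lte_fin gtrN//.
  by rewrite -EFinB opprK.
apply: le_measure; rewrite ?inE; last 2 first.
- exact: measurable_qball.
- move=> v /= vA; apply: eb; split => // i j; rewrite !ord1 mxE /ball/= sub0r normrN.
  by have := vA j; rewrite /A /= in_itv/= ltr_norml.
by apply: measurable_box => i; exact: measurable_itv.
Qed.

Lemma lebesgue_qball r : 0 < r ->
  lebesgue_rV (qball nrm r) = (r `^ Q * fine (lebesgue_rV (qball nrm 1)))%:E.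
Proof.
move=> r0; have ri0 : 0 < r^-1 by rewrite invr_gt0.
have -> : qball nrm r = dilation w r^-1 @^-1` qball nrm 1.
  apply/seteqP; split => x /=; rewrite /qball/= qn_dilation//;
  by rewrite ltr_pdivrMl// mulr1.
rewrite lebesgue_rV_dilation//; last exact: measurable_qball.
rewrite EFinM fineK ?ge0_fin_numE ?qball1_lty// powRN.
congr (_%:E * _)%E.
by rewrite -(powR_inv1 (ltW r0)) -powRrM mulN1r powRN invrK.
Qed.

Hypothesis N0 : (0 < N)%N.

Lemma hg_dim_gt0 : 0 < Q.
Proof.
rewrite /Q /hg_dim (bigD1 (Ordinal N0))//= ltr_wpDr ?hg_weight_gt0//.
by rewrite sumr_ge0// => i _; rewrite ltW// hg_weight_gt0.
Qed.

Lemma qball_volE x :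
  qball_vol nrm x = nrm x `^ Q * fine (lebesgue_rV (qball nrm 1)).
Proof.
rewrite /qball_vol; have := qn_ge0 nrm x; rewrite le_eqVlt => /predU1P[x0|x0].
  rewrite -x0 powR0 ?gt_eqF ?hg_dim_gt0// mul0r.
  rewrite (_ : qball _ _ = set0) ?measure0//; apply/seteqP; split => y //=.
  by rewrite /qball/= ltNge qn_ge0.
by rewrite lebesgue_qball.
Qed.

Let c := fine (lebesgue_rV (qball nrm 1)).
Let c0 : 0 < c.
Proof. by rewrite fine_gt0// qball1_gt0 qball1_lty. Qed.

Lemma qball_vol_ge0 x : 0 <= qball_vol nrm x.
Proof. by rewrite qball_volE mulr_ge0 ?powR_ge0 ?(ltW c0). Qed.

Lemma qball_vol_lt x y :
  (qball_vol nrm y < qball_vol nrm x) = (nrm y < nrm x).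
Proof.
rewrite !qball_volE ltr_pM2r//; apply/idP/idP => h.
  rewrite ltNge; apply: contraTN h => h; rewrite -leNgt.
  by apply: ge0_ler_powR; rewrite ?nnegrE ?qn_ge0 ?(ltW hg_dim_gt0).
by apply: gt0_ltr_powR; rewrite ?nnegrE ?qn_ge0 ?hg_dim_gt0.
Qed.

Lemma measurable_qball_vol : measurable_fun setT (qball_vol nrm).
Proof.
rewrite (_ : qball_vol nrm = fun x => nrm x `^ Q * c); last first.
  by apply/funext => x; exact: qball_volE.
apply: measurable_funM => //.
apply: (measurableT_comp (f := fun x => powR x Q)) => //.
apply: (@measurability _ _ _ _ _ _ (@RGenOpens.G R)).
  exact: RGenOpens.measurableE.
move=> _ [_ [a [b ->]] <-]; rewrite setTI; apply: open_measurable_rV.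
apply: open_comp => [x _|]; first exact: qn_continuous.
exact: interval_open.
Qed.

(** The key property of the group: {V < t} is the quasi-ball of volume t. *)
Lemma lebesgue_qball_vol_lt t : 0 < t ->
  lebesgue_rV [set x | qball_vol nrm x < t] = t%:E.
Proof.
move=> t0; have Q0 := hg_dim_gt0.
pose r := (t / c) `^ Q^-1.
have tc0 : 0 < t / c by rewrite divr_gt0.
have r0 : 0 < r by rewrite powR_gt0.
have rQ : r `^ Q * c = t.
  by rewrite -powRrM mulVf ?gt_eqF// powRr1 ?(ltW tc0)// divfK ?gt_eqF.
have -> : [set x | qball_vol nrm x < t] = qball nrm r.
  have ltE x : (qball_vol nrm x < t) = (nrm x `^ Q < r `^ Q).
    by rewrite qball_volE -{1}rQ ltr_pM2r.
  apply/seteqP; split => x; rewrite /qball/= ltE.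
    by apply: contraTT; rewrite -!leNgt => h; apply: ge0_ler_powR;
      rewrite ?nnegrE ?qn_ge0 ?(ltW Q0) ?(ltW r0).
  by move=> h; apply: gt0_ltr_powR; rewrite ?nnegrE ?qn_ge0 ?(ltW r0).
by rewrite lebesgue_qball// rQ.
Qed.

End quasi_ball.

(** * Integrals of powers and logarithms on the half-line *)

Section power_integrals.
Context {R : realType}.
Local Notation mu := (@lebesgue_measure R).

(** The primitive is only assumed to have a limit at 0, where f may blow up: the
    integral is the increasing limit of the integrals over [t/(n+2), t]. *)
Lemma ge0_FTC2_0c (f F : R -> R) (t : R) : 0 < t ->
  (forall x : R, 0 < x -> is_derive x 1 F (f x)) ->
  (forall x : R, 0 < x -> {for x, continuous f}) ->
  (forall x : R, 0 < x <= t -> 0 <= f x) -> F x @[x --> 0^'+] --> 0 ->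
  (\int[mu]_(x in `]0%R, t]) (f x)%:E = (F t)%:E)%E.
Proof.
move=> t0 dF cf f0 F0.
pose u (n : nat) : R := t / n.+2%:R.
have u0 n : 0 < u n by rewrite divr_gt0.
have ut n : u n < t by rewrite ltr_pdivrMr// ltr_pMr// ltr1n.
pose I n : set R := `[u n, t]%classic.
have II : \bigcup_n I n = `]0, t]%classic.
  apply/seteqP; split=> [x [n _]|x]; rewrite /I /= !in_itv/= => /andP[].
    by move=> ux ->; rewrite (lt_le_trans (u0 n)).
  move=> x0 xt; exists (Num.trunc (t / x)) => //=; rewrite in_itv/= xt andbT.
  rewrite /u ler_pdivrMr// mulrC -ler_pdivrMr//.
  by rewrite (le_trans (ltW (truncnS_gt _)))// ler_nat.
have cF x : 0 < x -> {for x, continuous F}.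
  by move=> /dF dx; apply: differentiable_continuous; apply/derivable1_diffP; exact: ex_derive.
have intI n : (\int[mu]_(x in I n) (f x)%:E = (F t)%:E - (F (u n))%:E)%E.
  apply: continuous_FTC2 => //.
  - apply: continuous_in_subspaceT => x; rewrite inE/= in_itv/= => /andP[ux _].
    by apply: cf; exact: lt_le_trans ux.
  - split.
    + move=> x; rewrite in_itv/= => /andP[ux _].
      by have := dF x (lt_trans (u0 n) ux) => h; exact: ex_derive.
    + by apply: cvg_at_right_filter; exact: cF.
    + by apply: cvg_at_left_filter; exact: cF.
  - move=> x; rewrite in_itv/= => /andP[ux _].
    by have := dF x (lt_trans (u0 n) ux) => h; rewrite derive1E derive_val.
have mI n : measurable (I n) by exact: measurable_itv.
have mf0 : measurable_fun (`]0, +oo[%classic : set R) f.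
  apply: open_continuous_measurable_fun => //.
  by move=> x; rewrite inE/= in_itv/= andbT => /cf.
have mf n : measurable_fun (I n) (fun x => (f x)%:E).
  apply/measurable_EFinP; apply: (measurable_funS _ _ mf0) => //.
  by move=> x; rewrite /I /= !in_itv/= andbT => /andP[ux _]; exact: lt_le_trans ux.
have nd : nondecreasing_seq I.
  move=> m n mn; apply/subsetPset => x; rewrite /I/= !in_itv/= => /andP[um ->].
  by rewrite andbT (le_trans _ um)// ler_pM2l// lef_pV2 ?posrE// ler_nat !ltnS.
have fI n x : I n x -> (0 <= (f x)%:E)%E.
  rewrite /I/= in_itv/= lee_fin => /andP[ux xt]; apply: f0.
  by rewrite xt andbT (lt_le_trans (u0 n)).
have := ge0_nondecreasing_set_cvg_integral (mu := mu) nd mI mf fI.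
rewrite II => /cvg_lim <- //.
apply/cvg_lim => //.
under eq_fun do rewrite intI -EFinB.
apply: cvg_EFin; first by near=> n.
rewrite -[X in _ --> X]subr0; apply: cvgB; first exact: cvg_cst.
move/cvg_at_rightP : F0; apply; split => //.
rewrite /u -(mulr0 t); apply: cvgM; first exact: cvg_cst.
have := @cvg_harmonic R; rewrite -cvg_shiftS; exact.
Unshelve. all: by end_near. Qed.

Lemma integral_powR_0c (c t : R) : 0 < c -> 0 < t ->
  (\int[mu]_(x in `]0%R, t]) (x `^ (c - 1))%:E = (t `^ c / c)%:E)%E.
Proof.
move=> c0 t0; pose F x : R := x `^ c / c.
apply: (@ge0_FTC2_0c _ F) => //.
- move=> x x0; have := is_derive1_powR c x0 => h.
  apply: is_derive_eq; rewrite scaler0 add0r.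
  by rewrite /GRing.scale/= mulrA mulVf ?mul1r// gt_eqF.
- move=> x x0; apply: differentiable_continuous; apply/derivable1_diffP.
  by have := is_derive1_powR (c - 1) x0 => h; exact: ex_derive.
- by move=> x _; exact: powR_ge0.
- rewrite /F -[X in _ --> X](mul0r c^-1); apply: cvgM; last exact: cvg_cst.
  exact: powR_cvg0.
Qed.

(** Squeeze: since ln y < y for y = x^(-e/2), the absolute value of x^e ln x is
    at most (2/e) x^(e/2) for x <= 1. *)
Lemma powR_ln_cvg0 (e : R) : 0 < e -> x `^ e * ln x @[x --> 0^'+] --> 0.
Proof.
move=> e0; rewrite -[X in _ --> X]oppr0.
rewrite (_ : (fun x => x `^ e * ln x) = (fun x => - (- (x `^ e * ln x)))); last first.
  by apply/funext => x; rewrite opprK.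
apply: cvgN; apply: (@squeeze_cvgr R (0^'+) _ R (cst 0)
  (fun x : R => 2 / e * x `^ (e / 2))).
- near=> x.
  have x0 : 0 < x by near: x; exact: nbhs_right_gt.
  have x1 : x <= 1 by near: x; apply: nbhs_right_le.
  rewrite /= -mulrN mulr_ge0 ?powR_ge0 ?oppr_ge0 ?ln_le0//=.
  have h : - ln x <= 2 / e * x `^ (- (e / 2)).
    have := ltW (ln_sublinear (powR_gt0 (- (e / 2)) x0)).
    rewrite ln_powR => h; rewrite -(ler_pM2l (_ : 0 < e / 2)); last by rewrite divr_gt0.
    rewrite mulrN -mulNr (le_trans h)// le_eqVlt; apply/orP; left; apply/eqP.
    by field; rewrite gt_eqF.
  have -> : e / 2 = e + - (e / 2) by lra.
  rewrite powRD ?(gt_eqF x0) ?implybT// mulrCA ler_pM2l ?powR_gt0//.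
- exact: cvg_cst.
- rewrite -[X in _ --> X](mulr0 (2 / e)); apply: cvgM; first exact: cvg_cst.
  by apply: powR_cvg0; rewrite divr_gt0.
Unshelve. all: by end_near. Qed.

(** The integrand is x^(e-1) ln x up to sign and a multiple of x^(e-1); in this
    form it is nonnegative. *)
Lemma integral_powR_ln_0c (e t : R) : 0 < e -> 0 < t ->
  (\int[mu]_(x in `]0%R, t]) (x `^ (e - 1) * (ln t - ln x))%:E =
   (t `^ e / e ^+ 2)%:E)%E.
Proof.
move=> e0 t0; pose F x : R := x `^ e / e * (ln t - ln x) + x `^ e / e ^+ 2.
have -> : t `^ e / e ^+ 2 = F t by rewrite /F subrr mulr0 add0r.
apply: ge0_FTC2_0c => //.
- move=> x x0; have := is_derive1_powR e x0 => h1; have := is_derive1_ln x0 => h2.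
  rewrite /F; apply: is_derive_eq.
  rewrite /GRing.scale/= powRB ?(gt_eqF x0) ?implybT// powRr1 ?(ltW x0)//.
  field; rewrite ?gt_eqF//.
- move=> x x0; apply: differentiable_continuous; apply/derivable1_diffP.
  have := is_derive1_powR (e - 1) x0 => h; have := is_derive1_ln x0 => h2; exact: ex_derive.
- move=> x /andP[x0 xt]; rewrite mulr_ge0 ?powR_ge0// subr_ge0 ler_ln//.
- have -> : F = fun x =>
      ln t / e * x `^ e - e^-1 * (x `^ e * ln x) + (e ^+ 2)^-1 * x `^ e.
    by apply/funext => x; rewrite /F; field; rewrite gt_eqF.
  rewrite [X in _ --> X](_ : 0 =
    ln t / e * 0 - e^-1 * 0 + (e ^+ 2)^-1 * 0); last by rewrite !mulr0; lra.
  apply: cvgD; last by apply: cvgM; [exact: cvg_cst|exact: powR_cvg0].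
  apply: cvgB; first by apply: cvgM; [exact: cvg_cst|exact: powR_cvg0].
  by apply: cvgM; [exact: cvg_cst|exact: powR_ln_cvg0].
Qed.

Lemma integral_powR_cy (c s : R) : 0 < c -> 0 < s ->
  (\int[mu]_(x in `[s, +oo[) (x `^ (- c - 1))%:E = (s `^ (- c) / c)%:E)%E.
Proof.
move=> c0 s0; pose F x : R := - (x `^ (- c) / c).
have cF (x : R) : 0 < x -> is_derive x 1 F (x `^ (- c - 1)).
  move=> x0; have := is_derive1_powR (- c) x0 => h1.
  rewrite /F; apply: is_derive_eq.
  by rewrite scaler0 add0r /GRing.scale/=; field; rewrite gt_eqF.
have cf x a : 0 < x -> {for x, continuous (fun x : R => x `^ a)}.
  move=> x0; apply: differentiable_continuous; apply/derivable1_diffP.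
  by have := is_derive1_powR a x0 => h; exact: ex_derive.
have F0 : F x @[x --> +oo] --> 0.
  rewrite /F -[X in _ --> X]oppr0; apply: cvgN.
  rewrite -[X in _ --> X](mul0r c^-1); apply: cvgM; last exact: cvg_cst.
  apply/cvgr0Pnorm_lt => e e0; near=> x.
  have xe : (e^-1) `^ c^-1 < x by near: x; exact: nbhs_pinfty_gt.
  have x0 : 0 < x by rewrite (le_lt_trans _ xe)// powR_ge0.
  rewrite ger0_norm ?powR_ge0// powRN -[ltRHS]invrK ltf_pV2 ?posrE ?powR_gt0 ?invr_gt0//.
  rewrite -[ltLHS]powRr1 ?invr_ge0 ?(ltW e0)// -(@mulVf _ c) ?gt_eqF//.
  by rewrite powRrM; apply: gt0_ltr_powR; rewrite ?nnegrE ?powR_ge0 ?(ltW x0).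
rewrite (ge0_continuous_FTC2y _ _ F0).
- by rewrite /F sub0e -EFinN opprK.
- by move=> x _; exact: powR_ge0.
- apply: continuous_in_subspaceT => x; rewrite inE/= in_itv/= andbT => sx.
  by apply: cf; exact: lt_le_trans sx.
- by move=> x sx; have := cF x (lt_trans s0 sx) => h; exact: ex_derive.
- apply: cvg_at_right_filter; apply: differentiable_continuous; apply/derivable1_diffP.
  by have := cF _ s0 => h; exact: ex_derive.
- move=> x; rewrite in_itv/= andbT => sx.
  by have := cF x (lt_trans s0 sx) => h; rewrite derive1E derive_val.
Unshelve. all: by end_near. Qed.
End power_integrals.

(** * Integrals of functions of V *)

Section radial.
Context {d : measure_display} {T : measurableType d} {R : realType}.
Variables (mu : {sigma_finite_measure set T -> \bar R}) (V : T -> R).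
Hypothesis mV : measurable_fun setT V.
Hypothesis V_ge0 : forall x, 0 <= V x.
Hypothesis V_lt : forall t : R, 0 < t -> mu [set x | V x < t] = t%:E.

(** Both measures give max(0, x) to the half-line of the y < x, and these
    half-lines generate the Borel sets. *)
Lemma pushforward_radial (A : set R) : measurable A -> A `<=` `[0, +oo[%classic ->
  pushforward mu V A = lebesgue_measure A.
Proof.
move=> mA A0.
have mV' : measurable_fun setT (V : T -> measurableTypeR R) by exact: mV.
pose m1 : {measure set (measurableTypeR R) -> \bar R} :=
  measure_function_pushforward__canonical__measure_function_Measure mu mV'.
have m0y : measurable (`[0, +oo[%classic : set (measurableTypeR R)).
  exact: measurable_itv.
pose m2 : {measure set (measurableTypeR R) -> \bar R} :=
  mrestr (@lebesgue_measure R) m0y.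
suff : m1 A = m2 A by rewrite /m1 /m2 /= /mrestr setIidl.
have m1E (x : R) : m1 `]-oo, x[%classic = (Num.max 0 x)%:E.
  rewrite /m1/= /pushforward (_ : V @^-1` _ = [set y | V y < x]); last first.
    by apply/seteqP; split => y; rewrite /= in_itv.
  have [x0|x0] := leP x 0; last by rewrite V_lt.
  rewrite (_ : [set y | _] = set0) ?measure0//; apply/seteqP; split => y //=.
  by rewrite ltNge (le_trans x0).
apply: (@measure_unique _ R (measurableTypeR R) (@RGenInftyO.G R)
    (fun n => `]-oo, n%:R[%classic)) => //.
- exact: RGenInftyO.measurableE.
- move=> _ _ [x ->] [y ->]; exists (Num.min x y).
  by apply/seteqP; split => z /=; rewrite !in_itv/= lt_min => /andP.
- by move=> n; exists n%:R.
- apply/seteqP; split => // x _; exists (Num.trunc x).+1 => //=.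
  by rewrite in_itv/= truncnS_gt.
- move=> _ [x ->]; rewrite m1E /m2/= /mrestr.
  rewrite (_ : _ `&` _ = `[0, x[%classic); last first.
    by apply/seteqP; split => y /=; rewrite !in_itv/= ?andbT;
      [move=> [-> ->]|move=> /andP[-> ->]].
  by rewrite lebesgue_measure_itv/= lte_fin; case: ltP => //; rewrite oppr0 adde0.
- by move=> n; rewrite m1E ltry.
Qed.

Lemma ge0_integral_radial (D : set R) (f : R -> \bar R) : measurable D ->
  D `<=` `[0, +oo[%classic -> measurable_fun D f ->
  (forall y, D y -> (0 <= f y)%E) ->
  (\int[mu]_(x in V @^-1` D) f (V x) = \int[lebesgue_measure]_(y in D) f y)%E.
Proof.
move=> mD D0 mf f0.
have mV' : measurable_fun setT (V : T -> measurableTypeR R) by exact: mV.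
rewrite -(ge0_integral_pushforward mV' mu)//; last by move=> y /set_mem/f0.
apply: eq_measure_integral => A mA AD; apply: pushforward_radial => //.
exact: subset_trans D0.
Qed.

Let ball t := [set x | V x < t].

Lemma radial_set0 : mu [set x | V x = 0] = 0.
Proof.
have := pushforward_radial (measurable_set1 0).
rewrite lebesgue_measure_set1; apply.
by move=> _ ->; rewrite /= in_itv/= lexx.
Qed.

Lemma ae_radial_gt0 : {ae mu, forall x, 0 < V x}.
Proof.
exists [set x | V x = 0]; split; last 2 first.
- exact: radial_set0.
- by move=> x /= /negP; rewrite -leNgt => Vx; apply/eqP; rewrite eq_le Vx V_ge0.
by rewrite -[X in measurable X]setTI; exact: (mV measurableT (measurable_set1 0)).
Qed.

Lemma measurable_sublevel t : measurable (ball t).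
Proof.
rewrite (_ : ball t = V @^-1` `]-oo, t[%classic).
  by rewrite -[X in measurable X]setTI; exact: mV.
by apply/seteqP; split => x; rewrite /ball/= in_itv.
Qed.

(** The null set {V = 0} is the only place where powers of V and ln V obey no
    identities; this removes it from a domain of integration. *)
Lemma integral_ball_gt0 (g : T -> \bar R) t : measurable_fun setT g ->
  (\int[mu]_(x in ball t) g x = \int[mu]_(x in V @^-1` `]0%R, t[) g x)%E.
Proof.
move=> mg; have mB := measurable_sublevel t.
have mD : measurable (V @^-1` `]0, t[%classic).
  by rewrite -[X in measurable X]setTI; apply: mV.
rewrite integral_mkcond [RHS]integral_mkcond; apply: ae_eq_integral => //.
- by apply/(measurable_restrictT g) => //; exact: measurable_funS mg.
- by apply/(measurable_restrictT g) => //; exact: measurable_funS mg.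
apply: filterS ae_radial_gt0 => x Vx _; rewrite !patchE.
congr (if _ then _ else _); apply/idP/idP => /set_mem; rewrite /ball/= => h; apply/mem_set.
  by rewrite /= in_itv/= Vx h.
by move: h; rewrite in_itv/= => /andP[].
Qed.

Lemma integral_ball_radial (f : R -> R) t : 0 < t -> measurable_fun setT f ->
  (forall y, 0 < y <= t -> 0 <= f y) ->
  (\int[mu]_(x in ball t) (f (V x))%:E =
   \int[lebesgue_measure]_(y in `]0%R, t]) (f y)%:E)%E.
Proof.
move=> t0 mf f0.
rewrite integral_ball_gt0; last by apply/measurable_EFinP; exact: measurableT_comp.
rewrite (@ge0_integral_radial _ (EFin \o f)).
- apply/esym/integral_itv_bndoo.
  by apply/measurable_EFinP; exact: measurable_funS mf.
- exact: measurable_itv.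
- by move=> x; rewrite /= !in_itv/= andbT => /andP[/ltW].
- by apply/measurable_EFinP; exact: measurable_funS mf.
- by move=> y; rewrite /= in_itv/= lee_fin => /andP[y0 yt]; rewrite f0// y0 ltW.
Qed.

Lemma integral_ball_powR c t : 0 < c -> 0 < t ->
  (\int[mu]_(x in ball t) (V x `^ (c - 1))%:E = (t `^ c / c)%:E)%E.
Proof.
move=> c0 t0; rewrite (@integral_ball_radial (fun y => y `^ (c - 1)))//.
  exact: integral_powR_0c.
by move=> y _; exact: powR_ge0.
Qed.

Lemma integral_tail_powR (i : bool) c s : 0 < c -> 0 < s ->
  (\int[mu]_(x in V @^-1` [set` Interval (BSide i s) +oo%O])
      (V x `^ (- c - 1))%:E =
   (s `^ (- c) / c)%:E)%E.
Proof.
move=> c0 s0.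
have mf D : measurable_fun (D : set R) (fun y => (y `^ (- c - 1))%:E).
  by apply/measurable_EFinP; exact: measurable_funS (measurable_powR _).
rewrite (@ge0_integral_radial _ (fun y => (y `^ (- c - 1))%:E)) //.
- by case: i; rewrite ?integral_itv_obnd_cbnd//; exact: integral_powR_cy.
- move=> x; rewrite /= !in_itv/= !andbT => sx; apply: le_trans (ltW s0) _.
  by case: i sx => // /ltW.
- by move=> y _; rewrite lee_fin powR_ge0.
Qed.

Let mpow a : measurable_fun setT (fun x => V x `^ a).
Proof. by apply: (measurableT_comp (f := fun y : R => y `^ a)). Qed.

Let mlnV : measurable_fun setT (fun x => ln (V x)).
Proof. by apply: (measurableT_comp (f := @ln R)) => //; exact: measurable_ln. Qed.

Lemma integrable_ball_powR c t : 0 < c -> 0 < t ->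
  mu.-integrable (ball t) (fun x => (V x `^ (c - 1))%:E).
Proof.
move=> c0 t0; apply/integrableP; split.
  by apply/measurable_EFinP; exact: measurable_funS (mpow _).
under eq_integral do rewrite gee0_abs ?lee_fin ?powR_ge0//.
by rewrite integral_ball_powR// ltry.
Qed.

Let mw e t : measurable_fun setT (fun y : R => y `^ (e - 1) * (ln t - ln y)).
Proof.
apply: measurable_funM => //; apply: measurable_funB => //.
Qed.

Lemma integral_ball_powR_lnB e t : 0 < e -> 0 < t ->
  (\int[mu]_(x in ball t) (V x `^ (e - 1) * (ln t - ln (V x)))%:E =
   (t `^ e / e ^+ 2)%:E)%E.
Proof.
move=> e0 t0; rewrite (@integral_ball_radial (fun y => y `^ (e - 1) * (ln t - ln y)))//.
  exact: integral_powR_ln_0c.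
move=> y /andP[y0 yt]; rewrite mulr_ge0 ?powR_ge0// subr_ge0 ler_ln//.
Qed.

Lemma integrable_ball_powR_lnB e t : 0 < e -> 0 < t ->
  mu.-integrable (ball t) (fun x => (V x `^ (e - 1) * (ln t - ln (V x)))%:E).
Proof.
move=> e0 t0.
have mg : measurable_fun (ball t) (fun x => (V x `^ (e - 1) * (ln t - ln (V x)))%:E).
  apply/measurable_EFinP; apply: (measurable_funS measurableT) => //.
  exact: (measurableT_comp (mw e t)).
apply/integrableP; split => //.
rewrite [ltLHS](_ : _ = (t `^ e / e ^+ 2)%:E) ?ltry//.
rewrite -integral_ball_powR_lnB//; apply: ae_eq_integral.
- exact: measurable_sublevel.
- by apply: measurableT_comp => //; exact: mg.
- exact: mg.
- apply: filterS ae_radial_gt0 => x Vx xb.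
  rewrite gee0_abs// lee_fin mulr_ge0 ?powR_ge0// subr_ge0 ler_ln//.
  exact: ltW.
Qed.

Lemma integral_ball_powR_ln e t : 0 < e -> 0 < t ->
  mu.-integrable (ball t) (fun x => (V x `^ (e - 1) * ln (V x))%:E) /\
  (\int[mu]_(x in ball t) (V x `^ (e - 1) * ln (V x))%:E =
   (t `^ e / e * (ln t - e^-1))%:E)%E.
Proof.
move=> e0 t0.
have E x : (V x `^ (e - 1) * ln (V x))%:E =
    ((ln t)%:E * (V x `^ (e - 1))%:E - (V x `^ (e - 1) * (ln t - ln (V x)))%:E)%E.
  by rewrite -EFinM -EFinB; congr EFin; ring.
have mB := measurable_sublevel t.
have i1 : mu.-integrable (ball t) (fun x => (ln t)%:E * (V x `^ (e - 1))%:E)%E.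
  by apply: integrableZl => //; exact: integrable_ball_powR.
have i2 := integrable_ball_powR_lnB e0 t0.
split.
  by under eq_fun do rewrite E; exact: integrableB.
under eq_integral do rewrite E.
rewrite integralB// integral_ball_powR_lnB// integralZl//; last exact: integrable_ball_powR.
rewrite integral_ball_powR// -EFinM -EFinB; congr EFin.
by field; rewrite gt_eqF.
Qed.
End radial.

(** * Jensen inequalities and the Tonelli kernel *)

Section ineqs.
Context {d : measure_display} {T : measurableType d} {R : realType}.
Local Open Scope ereal_scope.

(** The integral of a nonnegative function is a supremum over the simple
    functions below it, hence monotone without any measurability. *)
Lemma ge0_le_integralT (mu : {measure set T -> \bar R}) (f1 f2 : T -> \bar R) :
  (forall x, 0 <= f1 x <= f2 x) -> \int[mu]_x f1 x <= \int[mu]_x f2 x.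
Proof.
move=> f12; have f10 x : 0 <= f1 x by case/andP: (f12 x).
have f20 x : 0 <= f2 x by case/andP: (f12 x); exact: le_trans.
rewrite !ge0_integralTE//; apply: ereal_sup_le => _ [g gf <-].
by exists g => // x; rewrite (le_trans (gf x))//; case/andP: (f12 x).
Qed.

(** Measurability is asked of the larger function only, which spares proving that
    the geometric mean of f is a measurable function: the larger function is
    raised to +oo on the exceptional null set. *)
Lemma ae_ge0_le_integralT (mu : {measure set T -> \bar R}) (f1 f2 : T -> \bar R) :
  measurable_fun setT f2 -> (forall x, 0 <= f1 x) -> (forall x, 0 <= f2 x) ->
  {ae mu, forall x, f1 x <= f2 x} -> \int[mu]_x f1 x <= \int[mu]_x f2 x.
Proof.
move=> mf2 f10 f20 [N [mN N0 NP]].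
pose f3 x := if x \in N then +oo else f2 x.
have f30 x : 0 <= f3 x by rewrite /f3; case: ifP.
have mf3 : measurable_fun setT f3.
  apply: measurable_fun_ifT => //; apply: (measurable_fun_bool true).
  rewrite setTI (_ : _ @^-1` _ = N)//.
  by apply/seteqP; split=> x /=; [move/set_mem|move/mem_set].
rewrite (_ : \int[mu]_x f2 x = \int[mu]_x f3 x).
  apply: ge0_le_integralT => x; rewrite f10 /f3/=; case: ifPn; first by rewrite leey.
  by rewrite notin_setE => xN; apply: contrapT => h; apply: xN; exact: NP.
apply: ge0_ae_eq_integral => //.
exists N; split => // x /= /not_implyP[_]; rewrite /f3.
by case: ifPn => // /set_mem.
Qed.

(** Jensen's inequality for exp and the probability density c k on D.  If M is the
    exponent on the left, integrate exp u >= exp M (1 + u - M) for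
    u = p phi + psi.  The function phi need not be integrable: if the right-hand
    side is finite, the positive part of k phi has finite integral, so that
    either k phi is integrable or its integral is -oo and the left-hand side
    is 0. *)
Lemma jensen_expR (mu : {measure set T -> \bar R}) (D : set T)
    (k phi psi : T -> R) (p c : R) :
  measurable D -> measurable_fun setT k -> measurable_fun setT phi ->
  measurable_fun setT psi -> (forall x, 0 <= k x)%R -> (0 < p)%R -> (0 < c)%R ->
  \int[mu]_(x in D) (k x)%:E = (c^-1)%:E ->
  mu.-integrable D (fun x => (k x * psi x)%:E) ->
  expeR ((p * c)%:E * \int[mu]_(x in D) (k x * phi x)%:E +
         c%:E * \int[mu]_(x in D) (k x * psi x)%:E) <=
  c%:E * \int[mu]_(x in D) (k x * expR (p * phi x + psi x))%:E.
Proof.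
move=> mD mk mphi mpsi k0 p0 c0 k1 ipsi.
set S := \int[mu]_(x in D) (k x * expR _)%:E.
have S0 : 0 <= S.
  by apply: integral_ge0 => x _; rewrite lee_fin mulr_ge0 ?expR_ge0.
have mE : measurable_fun setT (fun x => k x * expR (p * phi x + psi x))%R.
  apply: measurable_funM => //; apply: measurableT_comp => //.
  by apply: measurable_funD => //; exact: measurable_funM.
have pc0 : (0 < p * c)%R by rewrite mulr_gt0.
have [->|Sfin] := eqVneq S +oo; first by rewrite mulry gtr0_sg// mul1e leey.
have mkphi : measurable_fun setT (fun x => (k x * phi x)%:E).
  by apply/measurable_EFinP; exact: measurable_funM.
set I := \int[mu]_(x in D) (k x * phi x)%:E.
have [J EJ] : exists J : R, \int[mu]_(x in D) (k x * psi x)%:E = J%:E.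
  by exists (fine (\int[mu]_(x in D) (k x * psi x)%:E)); rewrite fineK//; exact: integrable_fin_num.
rewrite EJ.
have [->|INy] := eqVneq I -oo.
  rewrite mulrNy gtr0_sg// mul1e /= mule_ge0// lee_fin ltW//.
have ik : mu.-integrable D (fun x => (k x)%:E).
  apply/integrableP; split; first by apply/measurable_EFinP; exact: measurable_funS mk.
  by under eq_integral do rewrite gee0_abs ?lee_fin//; rewrite k1 ltry.
have iE : mu.-integrable D (fun x => (k x * expR (p * phi x + psi x))%:E).
  apply/integrableP; split; first by apply/measurable_EFinP; exact: measurable_funS mE.
  under eq_integral do rewrite gee0_abs ?lee_fin ?mulr_ge0 ?expR_ge0//.
  by rewrite ltey.
pose h x := (k x * phi x)%:E.
(* the positive part of k phi is dominated by (k exp u + |k psi|) / p *)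
have iphi_p : \int[mu]_(x in D) h^\+ x < +oo.
  pose u x := p^-1%:E * ((k x * expR (p * phi x + psi x))%:E + `|(k x * psi x)%:E|).
  have iu : mu.-integrable D u.
    by apply: integrableZl => //; apply: integrableD => //; exact: integrable_abse.
  apply: (@le_lt_trans _ _ (\int[mu]_(x in D) u x)); last first.
    by rewrite ltey; move: (integrable_fin_num mD iu); rewrite fin_numE => /andP[].
  have u0 x : D x -> 0 <= u x.
    move=> _; apply: mule_ge0; first by rewrite lee_fin invr_ge0 ltW.
    by apply: adde_ge0 => //; rewrite lee_fin mulr_ge0 ?expR_ge0.
  apply: ge0_le_integral => //.
  - by apply: measurable_funepos; exact: measurable_funS mkphi.
  - by case/integrableP : iu.
  - move=> x Dx; rewrite funeposE ge_max u0// andbT /h.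
    rewrite /u /= -EFinM lee_fin -(ler_pM2l p0) mulVKf ?gt_eqF//.
    apply: (@le_trans _ _ (k x * (p * phi x + psi x) + `|k x * psi x|)%R).
      by have := ler_norm (- (k x * psi x))%R; rewrite normrN; lra.
    rewrite lerD2r ler_wpM2l//; apply: le_trans (expR_ge1Dx _).
    by rewrite lerDr.
have iphi : mu.-integrable D h.
  apply/integrableP; split; first exact: measurable_funS mkphi.
  have E x : `|h x| = h^\+ x + h^\- x by rewrite -[LHS]/((abse \o h) x) fune_abse.
  under eq_integral do rewrite E.
  rewrite ge0_integralD//; last 2 first.
  - by apply: measurable_funepos; exact: measurable_funS mkphi.
  - by apply: measurable_funeneg; exact: measurable_funS mkphi.
  rewrite lte_add_pinfty//; move: INy; rewrite /I integralE -/h.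
  have : \int[mu]_(x in D) h^\+ x \is a fin_num.
    by rewrite ge0_fin_numE// integral_ge0.
  by case: (\int[mu]_(x in D) h^\- x) => [r| |]//=; rewrite ?ltry//; case: (\int[mu]_(x in D) h^\+ x).
have [m Em] : exists m : R, I = m%:E.
  by exists (fine I); rewrite fineK//; exact: integrable_fin_num.
rewrite Em -!EFinM -EFinD /=.
set M := (p * c * m + c * J)%R.
(* lo is k times the tangent line of exp at M, evaluated at u *)
pose lo x := (expR M * (1 - M))%:E * (k x)%:E +
  ((expR M * p)%:E * h x + (expR M)%:E * (k x * psi x)%:E).
have ilo1 : mu.-integrable D (fun x => (expR M * (1 - M))%:E * (k x)%:E).
  exact: integrableZl.
have ilo2 : mu.-integrable D (fun x => (expR M * p)%:E * h x).
  exact: integrableZl.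
have ilo3 : mu.-integrable D (fun x => (expR M)%:E * (k x * psi x)%:E).
  exact: integrableZl.
have ilo23 := integrableD mD ilo2 ilo3.
have ilo := integrableD mD ilo1 ilo23.
have : \int[mu]_(x in D) lo x <= S.
  apply: le_integral => // x _.
  rewrite /lo /h -!EFinM -!EFinD lee_fin.
  have -> : (expR M * (1 - M) * k x + (expR M * p * (k x * phi x) + expR M * (k x * psi x)) =
    k x * (expR M * (1 + (p * phi x + psi x - M))))%R by ring.
  rewrite ler_wpM2l// -[leRHS](_ : expR M * expR (p * phi x + psi x - M) = _)%R; last first.
    by rewrite -expRD addrC subrK.
  by rewrite ler_wpM2l ?expR_ge0// expR_ge1Dx.
rewrite integralD// integralD// !integralZl// EJ k1 -/I Em -!EFinM -!EFinD.
move=> h1; rewrite -lee_pdivrMl// -EFinM (le_trans _ h1)// lee_fin.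
rewrite le_eqVlt; apply/orP; left; apply/eqP; rewrite /M.
by field; rewrite gt_eqF.
Qed.

(** The tangent line of y |-> y^r at m lies below the graph. *)
Lemma young_powR (r y m : R) : (1 <= r)%R -> (0 <= y)%R -> (0 < m)%R ->
  (r * (y * m `^ (r - 1)) <= y `^ r + (r - 1) * m `^ r)%R.
Proof.
rewrite le_eqVlt => /predU1P[<-|r1] y0 m0.
  by rewrite subrr powRr0 mulr1 mul1r mul0r addr0 powRr1.
have r0 : (0 < r)%R by rewrite (lt_trans _ r1).
have r10 : (0 < r - 1)%R by rewrite subr_gt0.
have := @conjugate_powR R y (m `^ (r - 1))%R r (r / (r - 1))%R y0 (powR_ge0 _ _) r0.
rewrite divr_gt0// => /(_ isT); rewrite -powRrM mulrCA divff ?gt_eqF// mulr1.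
have -> : (r^-1 + (r / (r - 1))^-1 = 1)%R by field; rewrite !gt_eqF.
move=> /(_ erefl); rewrite -(ler_pM2l r0) => /le_trans; apply.
rewrite le_eqVlt; apply/orP; left; apply/eqP.
by field; rewrite !gt_eqF.
Qed.

(** Jensen's inequality for the power r and the measure g dx, whose mass on D is
    at most G.  With A = int u g and B = int u^r g, integrate the tangent line
    inequality [young_powR] at m = A / G: r m^(r-1) A <= B + (r-1) m^r G. *)
Lemma power_mean (mu : {measure set T -> \bar R}) (D : set T) (u g : T -> R)
    (r G : R) :
  measurable D -> measurable_fun setT u -> measurable_fun setT g ->
  (forall x, 0 <= u x)%R -> (forall x, 0 <= g x)%R -> (1 <= r)%R -> (0 < G)%R ->
  \int[mu]_(x in D) (g x)%:E <= G%:E ->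
  (\int[mu]_(x in D) (u x * g x)%:E) `^ r <=
  (G `^ (r - 1))%:E * \int[mu]_(x in D) (u x `^ r * g x)%:E.
Proof.
move=> mD mu_ mg u0 g0 r1 G0 gG.
have r0 : (0 < r)%R by rewrite (lt_le_trans _ r1).
set A := \int[mu]_(x in D) (u x * g x)%:E.
set B := \int[mu]_(x in D) (u x `^ r * g x)%:E.
have A0 : 0 <= A by apply: integral_ge0 => x _; rewrite lee_fin mulr_ge0.
have B0 : 0 <= B by apply: integral_ge0 => x _; rewrite lee_fin mulr_ge0 ?powR_ge0.
have mug : measurable_fun D (fun x => (u x * g x)%:E).
  by apply/measurable_EFinP; apply: (measurable_funS measurableT) => //; exact: measurable_funM.
have mur : measurable_fun setT (fun x => u x `^ r)%R.
  by apply: (measurableT_comp (f := fun y : R => (y `^ r)%R)).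
have mug' : measurable_fun D (fun x => (u x `^ r * g x)%:E).
  by apply/measurable_EFinP; apply: (measurable_funS measurableT) => //; exact: measurable_funM.
have mg' : measurable_fun D (fun x => (g x)%:E).
  by apply/measurable_EFinP; exact: measurable_funS mg.
have key m : (0 < m)%R ->
    (r * m `^ (r - 1))%:E * A <= B + ((r - 1) * m `^ r)%:E * G%:E.
  move=> m0.
  have c0 : (0 <= (r - 1) * m `^ r)%R by rewrite mulr_ge0 ?powR_ge0// subr_ge0.
  apply: (@le_trans _ _ (B + ((r - 1) * m `^ r)%:E * \int[mu]_(x in D) (g x)%:E)); last first.
    by rewrite leeD2l// lee_pmul// ?lee_fin//; apply: integral_ge0 => x _; rewrite lee_fin.
  have g0' x : D x -> 0 <= (g x)%:E by rewrite lee_fin.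
  have ug0 x : D x -> 0 <= (u x * g x)%:E by rewrite lee_fin mulr_ge0.
  rewrite -(ge0_integralZl_EFin mu mD g0' mg' c0).
  rewrite -(ge0_integralZl_EFin mu mD ug0 mug); last first.
    by rewrite mulr_ge0 ?powR_ge0 ?(ltW r0).
  rewrite -ge0_integralD//; last 3 first.
  - by move=> x _; rewrite lee_fin mulr_ge0 ?powR_ge0.
  - by move=> x _; rewrite -EFinM lee_fin mulr_ge0.
  - exact: measurable_funeM.
  apply: ge0_le_integral => //.
  - by move=> x _; rewrite -EFinM lee_fin !mulr_ge0 ?powR_ge0 ?(ltW r0).
  - exact: measurable_funeM.
  - by apply: emeasurable_funD => //; exact: measurable_funeM.
  - move=> x _; rewrite -!EFinM -EFinD lee_fin.
    have := young_powR r1 (u0 x) m0 => /(ler_wpM2r (g0 x)) h.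
    apply: (le_trans _ (le_trans h _)); rewrite le_eqVlt; apply/orP; left; apply/eqP; ring.
have [Binf|Bfin] := eqVneq B +oo.
  by rewrite Binf mulry gtr0_sg ?powR_gt0// mul1e leey.
have [b Eb] : exists b : R, B = b%:E by exists (fine B); rewrite fineK// ge0_fin_numE// ltey.
have [Afin|] := boolP (A \is a fin_num); last first.
  rewrite ge0_fin_numE// -leNgt leye_eq => /eqP Ay.
  have := key 1%R ltr01; by rewrite Ay Eb powR1 mulr1 mulry gtr0_sg// mul1e.
have [a Ea] : exists a : R, A = a%:E by exists (fine A); rewrite fineK.
move: A0 B0 key; rewrite Ea Eb => a0 b0 key; rewrite lee_fin in a0 b0.
rewrite poweR_EFin -EFinM lee_fin.
have [->|] := eqVneq a 0%R.
  by rewrite powR0 ?gt_eqF// mulr_ge0 ?powR_ge0.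
move: a0; rewrite le_eqVlt eq_sym => /predU1P[->|a0 _]; first by rewrite eqxx.
have m0 : (0 < a / G)%R by rewrite divr_gt0.
have := key _ m0; rewrite -!EFinM -EFinD lee_fin.
set m := (a / G)%R; have aE : a = (m * G)%R by rewrite divfK// gt_eqF.
rewrite aE => h.
have mr : (m `^ r = m `^ (r - 1) * m)%R by rewrite mulrC mulr_powRB1// ltW.
have Gr : (G `^ r = G `^ (r - 1) * G)%R by rewrite mulrC mulr_powRB1// ltW.
rewrite powRM ?(ltW m0) ?(ltW G0)// Gr mulrCA ler_pM2l ?powR_gt0//.
rewrite mr in h *; lra.
Qed.

Section tonelli.
Variables (mu : {sigma_finite_measure set T -> \bar R}) (V : T -> R).
Hypothesis mV : measurable_fun setT V.
Hypothesis V_ge0 : forall x, (0 <= V x)%R.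
Hypothesis V_lt : forall t : R, (0 < t)%R -> mu [set x | (V x < t)%R] = t%:E.

Variables (s : R) (g : T -> R).
Hypotheses (s0 : (0 < s)%R) (mg : measurable_fun setT g) (g0 : forall x, (0 <= g x)%R).

Let mp k : measurable_fun setT (fun x => V x `^ k)%R.
Proof. by apply: (measurableT_comp (f := fun y : R => (y `^ k)%R)). Qed.

Let F (z : T * T) := if (V z.2 < V z.1)%R then
  (V z.1 `^ (- s - 1) * (V z.2 `^ s * g z.2))%:E else 0.

Let mF : measurable_fun setT F.
Proof.
apply: measurable_fun_ifT => //.
  by apply: measurable_fun_ltr; apply: (measurableT_comp (f := V)).
apply/measurable_EFinP; apply: measurable_funM.
  by apply: (measurableT_comp (f := fun x => V x `^ _)%R).
by apply: measurable_funM; [apply: (measurableT_comp (f := fun x => V x `^ _)%R)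
  |apply: (measurableT_comp (f := g))].
Qed.

Let F0 z : 0 <= F z.
Proof. by rewrite /F; case: ifP => // _; rewrite lee_fin !mulr_ge0 ?powR_ge0. Qed.

Let FE x : (V x `^ (- s - 1))%:E *
    \int[mu]_(y in [set y | (V y < V x)%R]) (V y `^ s * g y)%:E =
  \int[mu]_y F (x, y).
Proof.
rewrite -ge0_integralZl_EFin ?powR_ge0//; last 3 first.
- exact: (measurable_sublevel mV).
- by move=> y _; rewrite lee_fin mulr_ge0 ?powR_ge0.
- apply/measurable_EFinP; apply: (measurable_funS measurableT) => //.
  exact: measurable_funM.
rewrite integral_mkcond; apply: eq_integral => y _; rewrite patchE /F/=.
by rewrite mem_setE/=; case: ifP.
Qed.

Lemma measurable_hardy_kernel : measurable_fun setT (fun x =>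
  (V x `^ (- s - 1))%:E *
  \int[mu]_(y in [set y | (V y < V x)%R]) (V y `^ s * g y)%:E).
Proof.
under eq_fun do rewrite FE.
exact: measurable_fun_fubini_tonelli_F.
Qed.

(** After Tonelli, the inner integral of V(x)^(-s-1) over {V(x) > V(y)} equals
    V(y)^-s / s, which cancels the factor V(y)^s. *)
Lemma integral_hardy_kernel :
  \int[mu]_x ((V x `^ (- s - 1))%:E *
     \int[mu]_(y in [set y | (V y < V x)%R]) (V y `^ s * g y)%:E) =
  (s^-1)%:E * \int[mu]_x (g x)%:E.
Proof.
have mB' t : measurable [set x | (t < V x)%R].
  rewrite (_ : [set x | _] = V @^-1` `]t, +oo[%classic).
    by rewrite -[X in measurable X]setTI; exact: mV.
  by apply/seteqP; split => x; rewrite /= in_itv/= andbT.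
under eq_integral do rewrite FE.
rewrite fubini_tonelli// -ge0_integralZl_EFin ?invr_ge0 ?(ltW s0)//; last 2 first.
- by move=> y _; rewrite lee_fin.
- exact/measurable_EFinP.
apply: ae_eq_integral => //.
- exact: measurable_fun_fubini_tonelli_G.
- exact/measurable_funeM/measurable_EFinP.
apply: filterS (ae_radial_gt0 mV V_ge0 V_lt) => y Vy _.
transitivity ((V y `^ s * g y)%:E * \int[mu]_(x in [set x | (V y < V x)%R]) (V x `^ (- s - 1))%:E).
  rewrite -ge0_integralZl_EFin ?mulr_ge0 ?powR_ge0//; last 2 first.
  - by move=> x _; rewrite lee_fin powR_ge0.
  - by apply/measurable_EFinP; exact: measurable_funS (mp _).
  rewrite [RHS]integral_mkcond; apply: eq_integral => x _; rewrite patchE /F/=.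
  have -> : (x \in [set x | (V y < V x)%R]) = (V y < V x)%R.
    by apply/idP/idP => [/set_mem|h]//; exact/mem_set.
  by case: ifP => // _; rewrite -EFinM mulrC.
rewrite (_ : [set x | _] = V @^-1` [set` Interval (BRight (V y)) +oo%O]); last first.
  by apply/seteqP; split => x; rewrite /= in_itv/= andbT.
rewrite integral_tail_powR// -!EFinM powRN; congr EFin.
by field; rewrite !gt_eqF// powR_gt0.
Qed.
End tonelli.
End ineqs.

(** * Upper and lower bounds *)

Lemma gt0_powRE {R : realType} (x s : R) : 0 < x -> x `^ s = expR (s * ln x).
Proof. by move=> x0; rewrite /powR gt_eqF. Qed.

Lemma expR_powR {R : realType} (u s : R) : expR u `^ s = expR (s * u).
Proof. by rewrite /powR gt_eqF ?expR_gt0// expRK. Qed.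

Lemma expeR_poweR {R : realType} (u : \bar R) (q : R) : 0 < q ->
  (expeR u `^ q = expeR (q%:E * u))%E.
Proof.
move=> q0; case: u => [r| |] /=.
- by rewrite /powR gt_eqF ?expR_gt0// expRK.
- by rewrite mulry gtr0_sg// mul1e/= gt_eqF.
- by rewrite mulrNy gtr0_sg// mul1e/= powR0 ?gt_eqF.
Qed.

Section hardy.
Context {d : measure_display} {T : measurableType d} {R : realType}.
Variables (mu : {sigma_finite_measure set T -> \bar R}) (V : T -> R).
Hypothesis mV : measurable_fun setT V.
Hypothesis V_ge0 : forall x, 0 <= V x.
Hypothesis V_lt : forall t : R, 0 < t -> mu [set x | V x < t] = t%:E.

(** [exp_mean] with balls and volumes expressed through V alone. *)
Definition radial_mean (e : R) (f : T -> R) (x : T) : \bar R :=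
  expeR ((e * V x `^ (- e))%:E *
    \int[mu]_(y in [set y | (V y < V x)%R]) (V y `^ (e - 1) * ln (f y))%:E)%E.

Definition radial_hardy (p q a b e C : R) : Prop :=
  0 < C /\
  forall f : T -> R, measurable_fun setT f -> (forall x, 0 < f x) ->
  ((\int[mu]_x (radial_mean e f x `^ q * (V x `^ a)%:E)) `^ q^-1
   <= C%:E * (\int[mu]_x (f x `^ p * V x `^ b)%:E) `^ p^-1)%E.

Variables (p q a b e : R).
Hypotheses (p0 : 0 < p) (pq : p <= q) (e0 : 0 < e).
Let r := q / p.
Let q0 : 0 < q. Proof. exact: lt_le_trans pq. Qed.
Let r1 : 1 <= r. Proof. by rewrite /r ler_pdivlMr// mul1r. Qed.
Let r0 : 0 < r. Proof. exact: lt_le_trans r1. Qed.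

Let mp s : measurable_fun setT (fun x => V x `^ s).
Proof. by apply: (measurableT_comp (f := fun y : R => y `^ s)). Qed.

Let mlnV : measurable_fun setT (fun x => ln (V x)).
Proof. by apply: (measurableT_comp (f := @ln R)) => //; exact: measurable_ln. Qed.

Section upper.
Variables (f : T -> R).
Hypotheses (mf : measurable_fun setT f) (f0 : forall x, 0 < f x).
Let g x := f x `^ p * V x `^ b.

Let g0 x : 0 <= g x. Proof. by rewrite mulr_ge0 ?powR_ge0. Qed.
Let mg : measurable_fun setT g.
Proof.
apply: measurable_funM => //.
by apply: (measurableT_comp (f := fun y : R => y `^ p)).
Qed.
Let mB t : measurable [set x | V x < t]. Proof. exact: measurable_sublevel. Qed.

(** Jensen's inequality [jensen_expR] with phi = ln f and psi = (b+1) ln V, the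
    mean of ln V being ln t - 1/e. *)
Let radial_mean_powR_le x : 0 < V x ->
  (radial_mean e f x `^ p <=
   (e * V x `^ (- e - (b + 1)) * expR ((b + 1) / e))%:E *
   \int[mu]_(y in [set y | (V y < V x)%R]) (V y `^ e * g y)%:E)%E.
Proof.
move=> Vx; set t := V x; set B := [set y | _].
pose c := e * t `^ (- e).
have c0 : 0 < c by rewrite mulr_gt0 ?powR_gt0.
have ic : (\int[mu]_(y in B) (V y `^ (e - 1))%:E = (c^-1)%:E)%E.
  rewrite integral_ball_powR//; congr EFin.
  by rewrite /c powRN; field; rewrite !gt_eqF ?powR_gt0.
have [iln Eln] := integral_ball_powR_ln mV V_ge0 V_lt e0 Vx.
pose psi y := (b + 1) * ln (V y).
have Epsi y : ((V y `^ (e - 1) * psi y)%:E = (b + 1)%:E * (V y `^ (e - 1) * ln (V y))%:E)%E.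
  by rewrite -EFinM /psi; congr EFin; ring.
have ipsi : mu.-integrable B (fun y => (V y `^ (e - 1) * psi y)%:E).
  by under eq_fun do rewrite Epsi; exact: (integrableZl (mB _)).
have Ipsi : (\int[mu]_(y in B) (V y `^ (e - 1) * psi y)%:E =
    (c^-1 * ((b + 1) * (ln t - e^-1)))%:E)%E.
  under eq_integral do rewrite Epsi.
  rewrite (integralZl (mB _))// Eln -EFinM; congr EFin.
  by rewrite /c powRN; field; rewrite !gt_eqF ?powR_gt0.
have mlnf : measurable_fun setT (fun y => ln (f y)).
  by apply: (measurableT_comp (f := @ln R)) => //; exact: measurable_ln.
have mpsi : measurable_fun setT psi by exact: measurable_funM.
have := jensen_expR (mB _) (mp (e - 1)) mlnf mpsi (fun y => powR_ge0 _ _) p0 c0 ic ipsi.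
rewrite Ipsi -EFinM mulVKf ?gt_eqF// expeRD/=.
have -> : (\int[mu]_(y in B) (V y `^ (e - 1) * expR (p * ln (f y) + psi y))%:E =
  \int[mu]_(y in B) (V y `^ e * g y)%:E)%E.
  rewrite !integral_ball_gt0//; last 2 first.
  - by apply/measurable_EFinP; apply: measurable_funM.
  - apply/measurable_EFinP; apply: measurable_funM => //.
    by apply: measurableT_comp => //; apply: measurable_funD => //; exact: measurable_funM.
  apply: eq_integral => y /set_mem; rewrite /= in_itv/= => /andP[Vy _]; congr EFin.
  rewrite expRD -ln_powR lnK ?posrE ?powR_gt0// /psi -ln_powR lnK ?posrE ?powR_gt0//.
  rewrite /g mulrCA [RHS]mulrCA; congr (_ * _).
  by rewrite -!powRD ?(gt_eqF Vy) ?implybT//; congr (_ `^ _); ring.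
set A := (\int[mu]_(y in B) (V y `^ e * g y)%:E)%E.
have -> : (radial_mean e f x `^ p = expeR ((p * c)%:E *
    \int[mu]_(y in B) (V y `^ (e - 1) * ln (f y))%:E))%E.
  by rewrite /radial_mean expeR_poweR// EFinM muleA.
set X := expeR _.
move=> h.
rewrite -(lee_pmul2r _ (_ : 0 < (expR ((b + 1) * (ln t - e^-1)))%:E)%E)//; last first.
  by rewrite lte_fin expR_gt0.
apply: (le_trans h); rewrite muleAC -EFinM le_eqVlt; apply/orP; left; apply/eqP.
congr (_%:E * _)%E; rewrite /c powRB ?(gt_eqF Vx) ?implybT//.
have -> : expR ((b + 1) * (ln t - e^-1)) = t `^ (b + 1) * (expR ((b + 1) / e))^-1.
  by rewrite mulrBr expRD expRN -ln_powR lnK ?posrE ?powR_gt0.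
by field; rewrite !gt_eqF ?powR_gt0 ?expR_gt0.
Qed.

Let integral_weight_gt0 : (0 < \int[mu]_x (g x)%:E)%E.
Proof.
rewrite lt_neqAle integral_ge0 ?andbT; last by move=> x _; rewrite lee_fin.
apply/eqP => /esym g1; have : (\int[mu]_x `|(g x)%:E| = 0)%E.
  by under eq_integral do rewrite gee0_abs ?lee_fin//.
move/ae_eq_integral_abs => /(_ measurableT); case.
  exact/measurable_EFinP.
move=> N [mN N0 gN].
have [M [mM M0 VM]] := ae_radial_gt0 mV V_ge0 V_lt.
have : (mu [set x | (V x < 1)%R] <= mu (N `|` M))%E.
  apply: le_measure; rewrite ?inE//; first exact: measurableU.
  move=> x _; have [Vx|Vx] := boolP (0 < V x); [left|right].
    apply: gN => /= /(_ I) /eqP; rewrite eqe mulf_eq0 !powR_eq0.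
    by rewrite (gt_eqF (f0 x)) (gt_eqF Vx).
  by apply: VM => /=; exact/negP.
by rewrite V_lt// measureU0// N0 lee_fin ler10.
Qed.

(** The q-th power of the mean is the r-th power of the bound in
    [radial_mean_powR_le]; [power_mean] brings the power r inside the integral,
    and the hypothesis on a and b leaves exactly the kernel of
    [integral_hardy_kernel] with s = e r. *)
Lemma radial_hardy_upper : a + 1 = r * (b + 1) ->
  ((\int[mu]_x (radial_mean e f x `^ q * (V x `^ a)%:E)) `^ q^-1 <=
  ((p / q) `^ q^-1 * e `^ (p^-1 - q^-1) * expR ((b + 1) / (e * p)))%:E *
  (\int[mu]_x (f x `^ p * V x `^ b)%:E) `^ p^-1)%E.
Proof.
move=> D0.
have C0 : 0 < (p / q) `^ q^-1 * e `^ (p^-1 - q^-1) * expR ((b + 1) / (e * p)).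
  by rewrite !mulr_gt0 ?powR_gt0 ?expR_gt0 ?divr_gt0.
have := integral_weight_gt0.
set I := (\int[mu]_x (g x)%:E)%E => I0.
have [Iy|Iy] := eqVneq I +oo%E.
  by rewrite -/g -/I Iy poweRyr ?invr_eq0 ?gt_eqF// mulry gtr0_sg// mul1e leey.
have [G EG] : exists G : R, I = G%:E by exists (fine I); rewrite fineK// ge0_fin_numE ?ltey// ltW.
have G0 : 0 < G by rewrite -lte_fin -EG.
rewrite -/g -/I EG.
set K := expR (r * ((b + 1) / e)) * e `^ r * G `^ (r - 1).
have K0 : 0 < K by rewrite !mulr_gt0 ?powR_gt0 ?expR_gt0.
have er0 : 0 < e * r by rewrite mulr_gt0.
have pt x : 0 < V x -> (radial_mean e f x `^ q * (V x `^ a)%:E <=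
    K%:E * ((V x `^ (- (e * r) - 1))%:E *
     \int[mu]_(y in [set y | (V y < V x)%R]) (V y `^ (e * r) * g y)%:E))%E.
  move=> Vx; set t := V x; set B := [set y | _].
  have gG : (\int[mu]_(y in B) (g y)%:E <= G%:E)%E.
    rewrite -EG; apply: ge0_subset_integral => //; first exact: mB.
      exact/measurable_EFinP.
    by move=> y _; rewrite lee_fin.
  have := power_mean (mB _) (mp e) mg (fun y => powR_ge0 _ _) g0 r1 G0 gG.
  under [in leRHS]eq_integral do rewrite -powRrM.
  set A1 := (\int[mu]_(y in B) (V y `^ e * g y)%:E)%E.
  set A2 := (\int[mu]_(y in B) (V y `^ (e * r) * g y)%:E)%E => hA.
  have A10 : (0 <= A1)%E by apply: integral_ge0 => y _; rewrite lee_fin mulr_ge0 ?powR_ge0.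
  have -> : q = p * r by rewrite /r mulrCA divff ?gt_eqF// mulr1.
  have := radial_mean_powR_le Vx; rewrite -/A1 -/t => h.
  rewrite poweRrM.
  set k := e * _ * _ in h.
  have k0 : 0 < k by rewrite !mulr_gt0 ?powR_gt0 ?expR_gt0.
  apply: (@le_trans _ _ ((k%:E * A1) `^ r * (t `^ a)%:E)%E).
    rewrite lee_pmul2r ?lte_fin ?powR_gt0//; apply: gt0_ler_poweR => //.
    - exact: ltW.
    - by rewrite in_itv/= leey poweR_ge0.
    - by rewrite in_itv/= leey mule_ge0// lee_fin ltW.
  rewrite poweRM ?lee_fin ?(ltW k0)// poweR_EFin.
  apply: (@le_trans _ _ ((k `^ r)%:E * ((G `^ (r - 1))%:E * A2) * (t `^ a)%:E)%E).
    by rewrite lee_pmul2r ?lte_fin ?powR_gt0// lee_pmul2l ?lte_fin ?powR_gt0.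
  rewrite le_eqVlt; apply/orP; left; apply/eqP.
  rewrite [in RHS]muleA -[in RHS]EFinM [in LHS]muleA -EFinM muleAC -EFinM; congr (_%:E * _)%E.
  rewrite /K /k powRM ?mulr_ge0 ?powR_ge0 ?expR_ge0 ?(ltW e0)//.
  rewrite powRM ?powR_ge0 ?(ltW e0)// -powRrM.
  rewrite expR_powR.
  have -> : t `^ (- (e * r) - 1) = t `^ ((- e - (b + 1)) * r) * t `^ a.
    rewrite -powRD ?(gt_eqF Vx) ?implybT//; congr (_ `^ _).
    have -> : a = r * (b + 1) - 1 by rewrite -D0; ring.
    by ring.
  by ring.
have mker := measurable_hardy_kernel mu mV (e * r) mg g0.
have ker0 x : (0 <= (V x `^ (- (e * r) - 1))%:E *
     \int[mu]_(y in [set y | (V y < V x)%R]) (V y `^ (e * r) * g y)%:E)%E.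
  apply: mule_ge0; first by rewrite lee_fin powR_ge0.
  by apply: integral_ge0 => y _; rewrite lee_fin mulr_ge0 ?powR_ge0.
have upper : (\int[mu]_x (radial_mean e f x `^ q * (V x `^ a)%:E) <=
    (K * ((e * r)^-1 * G))%:E)%E.
  rewrite EFinM (EFinM _ G) -EG -(integral_hardy_kernel mV V_ge0 V_lt er0 mg g0).
  rewrite -(ge0_integralZl_EFin mu measurableT (fun x _ => ker0 x) mker (ltW K0)).
  apply: ae_ge0_le_integralT.
  - exact: measurable_funeM.
  - by move=> x; rewrite mule_ge0 ?poweR_ge0// lee_fin powR_ge0.
  - by move=> x; apply: mule_ge0; rewrite ?ker0// lee_fin ltW.
  - apply: filterS (ae_radial_gt0 mV V_ge0 V_lt) => x; exact: pt.
apply: le_trans (_ : ((K * ((e * r)^-1 * G))%:E `^ q^-1 <= _)%E).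
  apply: gt0_ler_poweR => //.
  - by rewrite invr_ge0 ltW.
  - rewrite in_itv/= leey andbT; apply: integral_ge0 => x _.
    by rewrite mule_ge0 ?poweR_ge0// lee_fin powR_ge0.
  - rewrite in_itv/= leey lee_fin andbT mulr_ge0 ?(ltW K0)// mulr_ge0 ?(ltW G0)//.
    by rewrite invr_ge0 ltW.
rewrite !poweR_EFin -EFinM lee_fin le_eqVlt; apply/orP; left; apply/eqP.
have -> : K * ((e * r)^-1 * G) =
    expR (r * ((b + 1) / e)) * e `^ (r - 1) * (p / q) * G `^ r.
  rewrite /K !powRB ?(gt_eqF e0) ?(gt_eqF G0) ?implybT// !powRr1 ?(ltW e0) ?(ltW G0)//.
  have -> : p / q = r^-1 by rewrite /r invf_div.
  by field; rewrite !gt_eqF.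
rewrite !powRM ?mulr_ge0 ?powR_ge0 ?expR_ge0 ?divr_ge0 ?invr_ge0 ?(ltW p0) ?(ltW q0)//.
rewrite -!powRrM expR_powR.
have -> : q^-1 * (r * ((b + 1) / e)) = (b + 1) / (e * p).
  by rewrite /r; field; rewrite !gt_eqF.
have -> : (r - 1) / q = p^-1 - q^-1 by rewrite /r; field; rewrite !gt_eqF.
have -> : r / q = p^-1 by rewrite /r; field; rewrite !gt_eqF.
by ring.
Qed.
End upper.

Section lower.
Variables (al k tau : R).
Hypotheses (al0 : 0 < al) (k0 : 0 < k) (tau0 : 0 < tau).

(** lg is the logarithm of f^p V^(b+1). *)
Let lg x := if V x < tau then al * (ln (V x) - ln tau)
            else ln k - al * (ln (V x) - ln tau).
Let f x := expR ((lg x - (b + 1) * ln (V x)) / p).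

Let mB t : measurable [set x | V x < t]. Proof. exact: measurable_sublevel. Qed.

Let mf : measurable_fun setT f.
Proof.
apply: measurableT_comp => //; apply: measurable_funM => //.
apply: measurable_funB; last exact: measurable_funM.
apply: measurable_fun_ifT => //.
- exact: measurable_fun_ltr.
- by apply: measurable_funM => //; exact: measurable_funB.
- by apply: measurable_funB => //; apply: measurable_funM => //; exact: measurable_funB.
Qed.

Let mfp : measurable_fun setT (fun x => (f x `^ p * V x `^ b)%:E).
Proof.
apply/measurable_EFinP; apply: measurable_funM => //.
by apply: (measurableT_comp (f := fun y : R => y `^ p)).
Qed.

Let fpE x : 0 < V x -> f x `^ p * V x `^ b = expR (lg x) * V x `^ (- 1).
Proof.
move=> Vx; rewrite /f expR_powR mulrC -[V x `^ b]lnK ?posrE ?powR_gt0// ln_powR.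
rewrite -[V x `^ (-1)]lnK ?posrE ?powR_gt0// ln_powR -!expRD; congr expR.
by field; rewrite gt_eqF.
Qed.

Let ballC : ~` [set x | V x < tau] = V @^-1` [set` Interval (BSide true tau) +oo%O].
Proof.
apply/seteqP; split => x; rewrite /= in_itv/= andbT.
  by move=> /negP; rewrite -leNgt.
by move=> h; apply/negP; rewrite -leNgt.
Qed.

Let integral_test :
  (\int[mu]_x (f x `^ p * V x `^ b)%:E = ((1 + k) / al)%:E)%E.
Proof.
have f0 x D : D x -> (0 <= (f x `^ p * V x `^ b)%:E)%E.
  by move=> _; rewrite lee_fin mulr_ge0 ?powR_ge0.
rewrite -(setUv [set x | V x < tau]) ge0_integral_setU//; last 4 first.
- exact: measurableC.
- by rewrite setUv.
- by move=> x; exact: (@f0 _ (fun=> _)).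
- by rewrite disj_set2E setICr.
have -> : (\int[mu]_(x in [set x | (V x < tau)%R]) (f x `^ p * V x `^ b)%:E = (al^-1)%:E)%E.
  transitivity (\int[mu]_(x in [set x | (V x < tau)%R])
      ((tau `^ (- al))%:E * (V x `^ (al - 1))%:E))%E.
    rewrite (integral_ball_gt0 mV V_ge0 V_lt _ mfp).
    rewrite (integral_ball_gt0 mV V_ge0 V_lt); last first.
      exact/measurable_funeM/measurable_EFinP.
    apply: eq_integral => x /set_mem; rewrite /= in_itv/= => /andP[Vx xt].
    rewrite -EFinM fpE// /lg xt powRB ?(gt_eqF Vx) ?implybT// powRr1 ?(ltW Vx)//.
    rewrite mulrBr expRB -!ln_powR !lnK ?posrE ?powR_gt0// powRN powR_inv1 ?(ltW Vx)//.
    by congr EFin; ring.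
  rewrite ge0_integralZl_EFin ?powR_ge0//; last 2 first.
  - by move=> x _; rewrite lee_fin powR_ge0.
  - by apply/measurable_EFinP; exact: measurable_funS (mp _).
  rewrite integral_ball_powR// -EFinM powRN; congr EFin.
  by field; rewrite !gt_eqF ?powR_gt0.
have -> : (\int[mu]_(x in ~` [set x | (V x < tau)%R]) (f x `^ p * V x `^ b)%:E = (k / al)%:E)%E.
  transitivity (\int[mu]_(x in ~` [set x | (V x < tau)%R])
      ((k * tau `^ al)%:E * (V x `^ (- al - 1))%:E))%E.
    apply: eq_integral => x /set_mem /= /negP; rewrite -leNgt => tx.
    have Vx := lt_le_trans tau0 tx.
    rewrite -EFinM fpE// /lg ltNge tx/= powRB ?(gt_eqF Vx) ?implybT// powRr1 ?(ltW Vx)//.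
    rewrite expRB lnK ?posrE// mulrBr expRB -!ln_powR !lnK ?posrE ?powR_gt0// powRN powR_inv1 ?(ltW Vx)//.
    by congr EFin; field; rewrite !gt_eqF ?powR_gt0.
  rewrite ge0_integralZl_EFin ?mulr_ge0 ?(ltW k0) ?powR_ge0//; last 3 first.
  - exact: measurableC.
  - by move=> x _; rewrite lee_fin powR_ge0.
  - by apply/measurable_EFinP; exact: measurable_funS (mp _).
  rewrite ballC integral_tail_powR// -EFinM powRN; congr EFin.
  by field; rewrite !gt_eqF ?powR_gt0.
by rewrite -EFinD; congr EFin; field; rewrite gt_eqF.
Qed.

Let D := a + 1 - r * (b + 1).

(** Where V < tau, the ball of x only sees the first branch of f, and ln f is an
    affine function of ln V. *)
Let radial_mean_test x : 0 < V x < tau ->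
  (radial_mean e f x `^ q * (V x `^ a)%:E =
   (expR (r * (b + 1 - al) / e) * tau `^ (- (al * r)) * V x `^ (D + al * r - 1))%:E)%E.
Proof.
move=> /andP[Vx xt]; set t := V x; pose B := [set y | V y < t].
have [iln Eln] := integral_ball_powR_ln mV V_ge0 V_lt e0 Vx.
have ipw := integrable_ball_powR mV V_ge0 V_lt e0 Vx.
pose A1 := (al - (b + 1)) / p; pose A0 : R := - (al * ln tau) / p.
have E : (\int[mu]_(y in B) (V y `^ (e - 1) * ln (f y))%:E =
    (t `^ e / e * (A1 * (ln t - e^-1) + A0))%:E)%E.
  transitivity (\int[mu]_(y in B) (A1%:E * (V y `^ (e - 1) * ln (V y))%:E +
      A0%:E * (V y `^ (e - 1))%:E))%E.
    apply: eq_integral => y /set_mem; rewrite /B/= => yt.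
    rewrite -!EFinM -EFinD /f expRK /lg (lt_trans yt xt); congr EFin.
    by rewrite /A1 /A0; field; rewrite gt_eqF.
  rewrite integralD//; [|exact: mB|exact: (integrableZl (mB _))|exact: (integrableZl (mB _))].
  rewrite !(integralZl (mB _))// Eln integral_ball_powR// -!EFinM -EFinD; congr EFin.
  by field; rewrite gt_eqF.
rewrite /radial_mean -/t -/B E expeR_poweR// -!EFinM/=; congr EFin.
have te : t `^ e != 0 by rewrite gt_eqF ?powR_gt0.
rewrite (gt0_powRE a Vx) (gt0_powRE (D + al * r - 1) Vx) (gt0_powRE _ tau0) -!expRD.
congr expR.
rewrite /A1 /A0 /D powRN /r.
field.
by rewrite te !gt_eqF.
Qed.

(** The test function f, with the integral on the left-hand side restricted to
    {0 < V < tau}; the hypothesis on al makes V^(D + al r - 1) integrable there.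
    The bound on the right-hand side is independent of tau. *)
Lemma radial_hardy_lower C : radial_hardy p q a b e C -> 0 < D + al * r ->
  (expR (r * (b + 1 - al) / e) * tau `^ D / (D + al * r)) `^ q^-1 <=
  C * ((1 + k) / al) `^ p^-1.
Proof.
move=> [C0 HC] s0.
have f0 x : 0 < f x by exact: expR_gt0.
have := HC f mf f0; rewrite integral_test poweR_EFin -EFinM.
set L := (\int[mu]_x _)%E => hL.
rewrite -lee_fin; apply: le_trans hL; rewrite -poweR_EFin.
have L0 : (0 <= L)%E.
  by apply: integral_ge0 => x _; rewrite mule_ge0 ?poweR_ge0// lee_fin powR_ge0.
set c := expR _ * _; have c0 : 0 < c by rewrite mulr_gt0 ?expR_gt0 ?powR_gt0.
apply: gt0_ler_poweR; rewrite ?invr_ge0 ?(ltW q0)//.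
- by rewrite in_itv/= leey lee_fin divr_ge0 ?ltW.
- by rewrite in_itv/= leey L0.
pose s := D + al * r.
pose K := expR (r * (b + 1 - al) / e) * tau `^ (- (al * r)).
have K0 : 0 < K by rewrite mulr_gt0 ?expR_gt0 ?powR_gt0.
have -> : ((c / s)%:E = \int[mu]_(x in V @^-1` `]0%R, tau[) (K%:E * (V x `^ (s - 1))%:E))%E.
  rewrite -integral_ball_gt0//; last by exact/measurable_funeM/measurable_EFinP.
  rewrite ge0_integralZl_EFin ?(ltW K0)//; last 2 first.
  - by move=> x _; rewrite lee_fin powR_ge0.
  - by apply/measurable_EFinP; exact: measurable_funS (mp _).
  rewrite integral_ball_powR// -EFinM /c /K /s powRD ?(gt_eqF tau0) ?implybT//.
  rewrite powRN; congr EFin; field.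
  by rewrite !gt_eqF ?powR_gt0.
rewrite integral_mkcond; apply: ge0_le_integralT => x; rewrite patchE.
case: ifPn => [/set_mem|_]; last first.
  by rewrite lexx mule_ge0 ?poweR_ge0// lee_fin powR_ge0.
rewrite /= in_itv/= => xt; rewrite radial_mean_test// -EFinM !lee_fin.
by rewrite mulr_ge0 ?(ltW K0) ?powR_ge0/=.
Qed.
End lower.
End hardy.

(** * The best constant *)

Section best.
Context {d : measure_display} {T : measurableType d} {R : realType}.
Variables (mu : {sigma_finite_measure set T -> \bar R}) (V : T -> R).
Hypothesis mV : measurable_fun setT V.
Hypothesis V_ge0 : forall x, 0 <= V x.
Hypothesis V_lt : forall t : R, 0 < t -> mu [set x | V x < t] = t%:E.
Variables (p q a b e : R).
Hypotheses (p0 : 0 < p) (pq : p <= q) (e0 : 0 < e).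
Let q0 : 0 < q. Proof. exact: lt_le_trans pq. Qed.

(** In [radial_hardy_lower] the left-hand side is a multiple of tau^(D/q), which is
    unbounded in tau > 0 unless D = 0. *)
Lemma radial_hardy_necessary C : radial_hardy mu V p q a b e C ->
  p * (a + 1) - q * (b + 1) = 0.
Proof.
move=> HC; set r := q / p; pose D := a + 1 - r * (b + 1).
have r1 : 1 <= r by rewrite /r ler_pdivlMr// mul1r.
suff D0 : D = 0.
  have -> : p * (a + 1) - q * (b + 1) = p * D.
    by rewrite /D /r; field; rewrite gt_eqF.
  by rewrite D0 mulr0.
apply/eqP/negPn/negP => Dn0.
(* large enough for D + al r > 0, as r >= 1 *)
pose al : R := 1 + `|D|.
have al0 : 0 < al by rewrite ltr_wpDr.
have s0 : 0 < D + al * r.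
  have : al <= al * r by rewrite ler_peMr// ltW.
  by have := ler_norm (- D); rewrite normrN /al; lra.
pose K1 := expR (r * (b + 1 - al) / e) / (D + al * r).
have K10 : 0 < K1 by rewrite divr_gt0 ?expR_gt0.
pose K2 := C * ((1 + 1) / al) `^ p^-1.
have K20 : 0 <= K2 by rewrite mulr_ge0 ?powR_ge0//; case: HC => /ltW.
pose M := (K2 `^ q + 1) / K1.
have M0 : 0 < M by rewrite divr_gt0// ltr_wpDl ?powR_ge0.
(* tau^D = M, and M exceeds what the inequality allows *)
pose tau := M `^ D^-1.
have tau0 : 0 < tau by rewrite powR_gt0.
have := radial_hardy_lower mV V_ge0 V_lt p0 pq e0 al0 ltr01 tau0 HC s0.
rewrite -/r -/D -powRrM mulVf// powRr1 ?(ltW M0)// mulrAC -/K1 -/K2.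
rewrite mulrC divfK ?gt_eqF// => h.
have : ((K2 `^ q + 1) `^ q^-1) `^ q <= K2 `^ q.
  by apply: ge0_ler_powR; rewrite ?nnegrE ?powR_ge0 ?(ltW q0).
rewrite -powRrM mulVf ?gt_eqF// powRr1 ?addr_ge0 ?powR_ge0//.
lra.
Qed.

(** [radial_hardy_lower] with al = e and tau = 1, in the limit k -> 0. *)
Lemma radial_hardy_lower_bound C : radial_hardy mu V p q a b e C ->
  p * (a + 1) - q * (b + 1) = 0 ->
  (p / q) `^ q^-1 * e `^ (p^-1 - q^-1) * expR ((b + 1) / (e * p) - p^-1) <= C.
Proof.
move=> HC hab; set r := q / p.
have C0 : 0 < C by case: HC.
have r1 : 1 <= r by rewrite /r ler_pdivlMr// mul1r.
have r0 : 0 < r by apply: lt_le_trans r1.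
have D0 : a + 1 - r * (b + 1) = 0.
  have -> : a + 1 - r * (b + 1) = (p * (a + 1) - q * (b + 1)) / p.
    by rewrite /r; field; rewrite gt_eqF.
  by rewrite hab mul0r.
have s0 : 0 < a + 1 - r * (b + 1) + e * r by rewrite D0 add0r mulr_gt0.
set L := (X in X <= C).
have L0 : 0 < L by rewrite !mulr_gt0 ?powR_gt0 ?expR_gt0 ?divr_gt0.
have key k : 0 < k -> L <= C * (1 + k) `^ p^-1.
  move=> k0.
  have := radial_hardy_lower mV V_ge0 V_lt p0 pq e0 e0 k0 ltr01 HC s0.
  rewrite -/r D0 add0r powR1 mulr1.
  rewrite [in X in _ <= X]powRM ?invr_ge0 ?(ltW e0) ?addr_ge0 ?(ltW k0)// mulrA.
  rewrite -ler_pdivrMr ?powR_gt0 ?invr_gt0//; apply: le_trans.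
  rewrite le_eqVlt; apply/orP; left; apply/eqP.
  have -> : expR (r * (b + 1 - e) / e) / (e * r) =
      expR (r * (b + 1 - e) / e) * (p / q) * e `^ (-1).
    by rewrite powR_inv1 ?(ltW e0)// /r; field; rewrite !gt_eqF.
  have -> : e^-1 `^ p^-1 = e `^ (- p^-1).
    by rewrite -(powR_inv1 (ltW e0)) -powRrM mulN1r.
  rewrite /L; have : 0 <= p / q by rewrite divr_ge0 ?ltW.
  move: (p / q) => pq' pq0.
  rewrite !powRM ?mulr_ge0 ?expR_ge0 ?powR_ge0//.
  rewrite -powRrM expR_powR powRN invrK.
  have -> : q^-1 * (r * (b + 1 - e) / e) = (b + 1) / (e * p) - p^-1.
    by rewrite /r; field; rewrite !gt_eqF.
  rewrite powRB ?(gt_eqF e0) ?implybT// mulN1r powRN.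
by ring.
rewrite leNgt; apply/negP => CL.
(* k = rho^p - 1 with 1 < rho < L / C contradicts key *)
pose rho := (1 + L / C) / 2.
have LC : 1 < L / C by rewrite ltr_pdivlMr// mul1r.
have rho1 : 1 < rho by rewrite /rho; lra.
have rho0 : 0 < rho by lra.
have k0 : 0 < rho `^ p - 1.
  have h := gt0_ltr_powR p0 (_ : 1 \is Num.nneg) (_ : rho \is Num.nneg) rho1.
  by have := h; rewrite powR1 subr_gt0; apply; rewrite nnegrE ?ltW.
have := key _ k0; rewrite addrC subrK -powRrM divff ?gt_eqF// powRr1 ?(ltW rho0)//.
rewrite mulrC -ler_pdivrMr// /rho; lra.
Qed.

(** The best constant is the infimum of the admissible ones. It is admissible: for
    fixed f, the inequality passes to the limit in C if its right-hand side is
    finite, and if not, it holds because the infimum is positive. *)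
Lemma radial_hardy_best :
  p * (a + 1) - q * (b + 1) = 0 ->
  exists C, [/\ radial_hardy mu V p q a b e C,
    (forall C', radial_hardy mu V p q a b e C' -> C <= C') &
    C <= (p / q) `^ q^-1 * e `^ (p^-1 - q^-1) * expR ((b + 1) / (e * p))].
Proof.
move=> hab; set U := (p / q) `^ q^-1 * e `^ (p^-1 - q^-1) * expR ((b + 1) / (e * p)).
pose S := [set C | radial_hardy mu V p q a b e C].
have SU : S U.
  split; first by rewrite !mulr_gt0 ?powR_gt0 ?expR_gt0 ?divr_gt0.
  move=> f mf f0; apply: radial_hardy_upper => //.
  apply/eqP; rewrite -subr_eq0.
  have -> : a + 1 - q / p * (b + 1) = (p * (a + 1) - q * (b + 1)) / p.
    by field; rewrite gt_eqF.
  by rewrite hab mul0r.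
set L := (p / q) `^ q^-1 * e `^ (p^-1 - q^-1) * expR ((b + 1) / (e * p) - p^-1).
have LS : lbound S L by move=> C HC; exact: radial_hardy_lower_bound.
have L0 : 0 < L by rewrite !mulr_gt0 ?powR_gt0 ?expR_gt0 ?divr_gt0.
have infS : has_inf S by split; [exists U|exists L].
have inf0 : 0 < inf S.
  by apply: lt_le_trans L0 _; apply: lb_le_inf => //; exists U.
exists (inf S); split.
- split=> // f mf f0.
  set I := (\int[mu]_x (f x `^ p * V x `^ b)%:E)%E.
  have I0 : (0 <= I)%E.
    by apply: integral_ge0 => x _; rewrite lee_fin mulr_ge0 ?powR_ge0.
  have [Iy|Iy] := eqVneq I +oo%E.
    by rewrite Iy poweRyr ?invr_eq0 ?gt_eqF// mulry gtr0_sg// mul1e leey.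
  have [G EG] : exists G : R, I = G%:E by exists (fine I); rewrite fineK// ge0_fin_numE ?ltey.
  have HS C : S C -> (((\int[mu]_x (radial_mean mu V e f x `^ q * (V x `^ a)%:E)) `^ q^-1
      <= (C * G `^ p^-1)%:E)%E).
    by move=> [_ /(_ f mf f0)]; rewrite -/I EG poweR_EFin EFinM.
  rewrite EG poweR_EFin -EFinM.
  move: HS; set X := (X in (X `^ _ <= _)%E) => HS.
  have GX : 0 <= G `^ p^-1 by exact: powR_ge0.
  apply/lee_addgt0Pr => h h0.
  pose dlt := h / (1 + G `^ p^-1).
  have dlt0 : 0 < dlt by rewrite divr_gt0// ltr_wpDr.
  have [C SC Ch] := inf_adherent dlt0 infS.
  apply: (le_trans (HS C SC)); rewrite -EFinD lee_fin.
  apply: (@le_trans _ _ ((inf S + dlt) * G `^ p^-1)); first by rewrite ler_wpM2r// ltW.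
  rewrite mulrDl lerD2l /dlt mulrAC ler_pdivrMr ?ltr_wpDr//.
  by rewrite ler_wpM2l ?(ltW h0)// lerDr.
- by move=> C HC; apply: ge_inf => //; exists L.
- by apply: ge_inf => //; exists L.
Qed.
End best.

Section group.
Context {R : realType} {N : nat} (G : homogeneous_group R N).
Variable nrm : quasi_norm G.
Hypothesis N0 : (0 < N)%N.

(** As V is increasing in the quasi-norm, the quasi-ball of radius |x| is
    {V < V(x)}. *)
Lemma hardy_constantE p q a b e C : hardy_constant nrm p q a b e C =
  radial_hardy (@lebesgue_rV R N) (qball_vol nrm) p q a b e C.
Proof.
suff E : exp_mean nrm e = radial_mean lebesgue_rV (qball_vol nrm) e.
  by rewrite /hardy_constant E.
apply/funext => f; apply/funext => x.
rewrite /exp_mean /radial_mean (_ : qball nrm (nrm x) =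
  [set y | qball_vol nrm y < qball_vol nrm x])//.
by apply/seteqP; split => y; rewrite /qball/= qball_vol_lt.
Qed.
End group.

Theorem theorem1p5 (R : realType) (N : nat) (hN : (0 < N)%N)
  (G : homogeneous_group R N) (Q : R) (hQ : Q = hg_dim G) (nrm : quasi_norm G)
  (p q a b eps : R) (hp : 0 < p) (hpq : p <= q) (heps : 0 < eps) :
  ((exists C, hardy_constant nrm p q a b eps C) <->
     p * (a + 1) - q * (b + 1) = 0) /\
  (p * (a + 1) - q * (b + 1) = 0 ->
     exists C, best_hardy_constant nrm p q a b eps C /\
       (p / q) `^ q^-1 * eps `^ (p^-1 - q^-1) *
         expR ((b + 1) / (eps * p) - p^-1) <= C /\
       C <= (p / q) `^ q^-1 * eps `^ (p^-1 - q^-1) *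
         expR ((b + 1) / (eps * p))).
Proof.
have mV := measurable_qball_vol nrm hN.
have V0 := qball_vol_ge0 nrm hN.
have Vlt t : 0 < t -> lebesgue_rV [set x | qball_vol nrm x < t] = t%:E.
  exact: lebesgue_qball_vol_lt.
split; first split.
- move=> [C]; rewrite hardy_constantE//.
  exact: (radial_hardy_necessary mV V0 Vlt hp hpq heps).
- move=> hab; have [C [HC _ _]] := radial_hardy_best mV V0 Vlt hp hpq heps hab.
  by exists C; rewrite hardy_constantE.
- move=> hab; have [C [HC Cmin CU]] := radial_hardy_best mV V0 Vlt hp hpq heps hab.
  exists C; split; last first.
    by split => //; exact: (radial_hardy_lower_bound mV V0 Vlt hp hpq heps HC).
  split; first by rewrite hardy_constantE.
  by move=> C'; rewrite hardy_constantE//; exact: Cmin.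
Qed.
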